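(* Let $M$ be a loop- and coloop-free matroid in $\mathrm{CH}(6)$, i.e. such that every chain in the lattice $\mathcal Z(M)$ of cyclic flats of $M$ has at most $6$ elements. Then $$T_M(2,0)\,T_M(0,2)\ge T_M(1,1)^2 .$$
   Context: All matroids are finite. $T_M(x,y)$ denotes the Tutte polynomial of $M$. A cyclic flat of $M$ is a flat that is a (possibly empty) union of circuits; $\mathcal Z(M)$ is the lattice of cyclic flats of $M$ ordered by inclusion. For a poset $P$, $h(P)$ is the maximum size (number of elements) of a chain of $P$. For $k\ge 1$, $\mathrm{CH}(k)=\{M: h(\mathcal Z(M))\le k\}$. The multiplicative Merino--Welsh inequality for a loop- and coloop-free matroid $M$ is $T_M(2,0)T_M(0,2)\ge T_M(1,1)^2$. *)

(* Defs.v *)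
From HB Require Import structures.
From mathcomp Require Import all_boot all_order all_algebra.

Set Implicit Arguments.
Unset Strict Implicit.
Unset Printing Implicit Defensive.

Import Order.TTheory GRing.Theory Num.Theory.
Local Open Scope ring_scope.

(* The ground set is the whole finite type [T], which may be empty. *)
Record matroid (T : finType) := Matroid {
  indep : pred {set T};
  indep0 : indep set0;
  indepS : forall I J : {set T}, I \subset J -> indep J -> indep I;
  indep_aug : forall I J : {set T}, indep I -> indep J -> (#|I| < #|J|)%N ->
    exists2 e, e \in J :\: I & indep (e |: I)
}.

Section MatroidNotions.

Variables (T : finType) (M : matroid T).
Implicit Types A B C F : {set T}.

Definition is_basis B := maxset (indep M) B.

Definition is_circuit C := minset (predC (indep M)) C.

Definition is_loop (e : T) := is_circuit [set e].

Definition is_coloop (e : T) := [forall (B | is_basis B), e \in B].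

Definition rank A : nat := \max_(I : {set T} | indep M I && (I \subset A)) #|I|.

Definition is_flat F := [forall e in ~: F, (rank F < rank (e |: F))%N].

Definition is_cyclic A :=
  [exists S : {set {set T}}, [forall C in S, is_circuit C] && (cover S == A)].

Definition cyclic_flats : {set {set T}} := [set F | is_flat F && is_cyclic F].

(* The outer variable of [{poly {poly int}}] is x and the inner one is y, in
   accordance with [p.[x, y] = p.[x%:P].[y]]. Both truncated subtractions are
   exact. *)
Definition tutte : {poly {poly int}} :=
  \sum_(A : {set T})
    ('X - 1) ^+ (rank setT - rank A) * ('Y - 1) ^+ (#|A| - rank A).

End MatroidNotions.

Section Height.

Variable T : finType.
Implicit Types P C : {set {set T}}.

Definition is_chain C :=
  [forall A in C, forall B in C, (A \subset B) || (B \subset A)].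

(* Chains are measured by their number of elements, not by their length, in a
   family [P] of sets ordered by inclusion. *)
Definition height P : nat :=
  \max_(C : {set {set T}} | is_chain C && (C \subset P)) #|C|.

End Height.

Definition CH (k : nat) (T : finType) (M : matroid T) : bool :=
  (height (cyclic_flats M) <= k)%N.

(* Main.v *)
(* The ratio T(2,0) T(0,2) / T(1,1)^2 is studied by deletion and contraction,
   using T(2,0)(N \ e) >= T(2,0)(N / e) and T(0,2)(N / e) >= T(0,2)(N \ e).

   By Cauchy-Schwarz the ratio is at least 1 for N as soon as it is for N \ e
   and N / e, so one may assume that every element has a parallel or a series
   partner.  A parallel class of size at least three can be shortened, and what
   remains is a matroid in which some elements P have been doubled in parallel
   and the others S in series.  There the lattice of cyclic flats contains a
   chain of r(P) + r*(S) + 1 elements, hence r(P) + r*(S) <= 5.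

   Deleting or contracting a whole parallel pair e, the ratio of N is at least
   the minimum of that of N \ e and 5/6 of that of N / e.  A contraction lowers r(P) + r*(S), and the
   connected base cases (doubled circuits and their relatives) have ratio at
   least 36/25, mostly 7/4, which leaves room for the contractions needed. *)

Require Import Defs.
From mathcomp Require Import all_boot all_order all_algebra.
From mathcomp Require Import zify ring lra.

Import Order.TTheory GRing.Theory Num.Theory.
Local Open Scope ring_scope.

Set Implicit Arguments.
Unset Strict Implicit.
Unset Printing Implicit Defensive.

(** The doubled matroid is never built. The nonempty subsets of a parallel pair contribute 1 + 1 +
    (Y - 1) = 1 + Y, and a series pair dually contributes 1 + X, so a pair is one element carrying a
    weight. Loops in [S] and coloops in [P] are harmless: such a pair is a 2-circuit with factor X +
    Y, which is 2 at all three points. For an element of [P] the contraction has weights 1, 3 and 2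
    at (2,0), (0,2) and (1,1). As 2^2 > 1 * 3, Cauchy-Schwarz no longer closes the step: the ratio
    of the contraction must exceed the target by a factor 6/5. Hence a stronger statement is proved,
    whose bound grows as k = r(P) + r*(S) falls: 1, 6/5, 36/25, 7/4, 21/10 for k = 5, 4, 3, 2, 1. It
    is consistent because (6/5)^3 < 7/4 and 6/5 * 7/4 = 21/10, and it is used up at k = 5. Small
    matroids and sums of loops and coloops miss these values, so the bound also depends on the
    number of elements and on the presence of an element that is neither a loop nor a coloop. *)

Lemma set_ind (T : finType) (Q : {set T} -> Prop) :
  Q set0 -> (forall e (A : {set T}), e \notin A -> Q A -> Q (e |: A)) ->
  forall A, Q A.
Proof.
move=> Q0 QS A; have [n] := ubnP #|A|; elim: n A => // n IH A lt_A.
have [->//|[e eA]] := set_0Vmem A.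
rewrite -(setD1K eA); apply: QS; first by rewrite setD11.
by apply: IH; move: lt_A; rewrite (cardsD1 e A) eA.
Qed.

(** * Rank functions, contraction and duality *)

Record rank_fun (T : finType) (r : {set T} -> nat) : Prop := RankFun {
  rk0 : r set0 = 0%N;
  rk_mono : forall A B : {set T}, A \subset B -> (r A <= r B)%N;
  rk_add1 : forall e (A : {set T}), (r (e |: A) <= (r A).+1)%N;
  (* Submodularity in closure form: an element spanned by a set stays spanned by every larger set.
     [rk_dim] and [rk_submod] recover the usual inequality. *)
  rk_cl : forall e (A B : {set T}), A \subset B -> r (e |: A) = r A ->
    r (e |: B) = r B
}.

(** Rank functions live on all subsets of [T] and deletion is the passage to a smaller ground set
    [E], so no operation changes the type. The subtraction is exact by monotonicity, and [e] itself
    becomes a loop. *)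
Definition ctr (T : finType) (r : {set T} -> nat) (e : T) (A : {set T}) : nat :=
  (r (e |: A) - r [set e])%N.

(** Intersecting with [E] makes the elements outside [E] loops of the dual, which is thus a rank
    function on all of [T]. The subtraction is exact by [dualrK]. *)
Definition dualr (T : finType) (r : {set T} -> nat) (E A : {set T}) : nat :=
  (#|A :&: E| + r (E :\: A) - r E)%N.

Section RankFunctions.

Variables (T : finType) (r : {set T} -> nat).
Hypothesis rr : rank_fun r.
Implicit Types (A B E : {set T}) (e f : T).

Lemma rk_addge e A : (r A <= r (e |: A))%N.
Proof. by apply: (rk_mono rr); apply: subsetUr. Qed.

Lemma rk_dim e A B : A \subset B -> (r (e |: B) + r A <= r (e |: A) + r B)%N.
Proof.
move=> AB; have := rk_addge e A; have := rk_add1 rr e A; have := rk_add1 rr e B.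
have := @rk_cl _ _ rr e _ _ AB.
case: (r (e |: A) =P r A) => [h /(_ h)|]; lia.
Qed.

Lemma rk1 e : (r [set e] <= 1)%N.
Proof. by have := rk_add1 rr e set0; rewrite setU0 (rk0 rr). Qed.

Lemma rk_submod A B X : A \subset B ->
  (r (X :|: B) + r A <= r (X :|: A) + r B)%N.
Proof.
move=> AB; elim/(@set_ind T): X => [|e X _ IH].
  by rewrite !set0U addnC.
rewrite -!setUA.
have := @rk_dim e (X :|: A) (X :|: B) (setUS _ AB); lia.
Qed.

Lemma rk_setU A B : (r (A :|: B) <= r A + #|B|)%N.
Proof.
elim/(@set_ind T): B => [|e B eB IH]; first by rewrite setU0 cards0 addn0.
rewrite setUCA cardsU1 eB; have := rk_add1 rr e (A :|: B); lia.
Qed.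

Lemma rk_card A : (r A <= #|A|)%N.
Proof. by have := rk_setU set0 A; rewrite set0U (rk0 rr). Qed.

Lemma rk_setD A B : (r A <= r (A :\: B) + #|A :&: B|)%N.
Proof.
apply: leq_trans (rk_setU _ _); apply: (rk_mono rr).
by rewrite setUC setID.
Qed.

Lemma rk_setD1 e A : (r A <= (r (A :\ e)).+1)%N.
Proof.
have := rk_setD A [set e]; have : (#|A :&: [set e]| <= 1)%N.
  by rewrite -(cards1 e); apply/subset_leq_card/subsetIr.
lia.
Qed.

Lemma rk_setD1_le e A : (r (A :\ e) <= r A)%N.
Proof. by apply: (rk_mono rr); apply: subsetDl. Qed.

Lemma ctrK e A : (ctr r e A + r [set e] = r (e |: A))%N.
Proof. by rewrite /ctr subnK //; apply: (rk_mono rr); apply: subsetUl. Qed.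

Lemma ctr_rank e : rank_fun (ctr r e).
Proof.
split=> [|A B AB|f A|f A B AB].
- by rewrite /ctr setU0 subnn.
- by apply: leq_sub2r; apply: (rk_mono rr); apply: setUS.
- have := ctrK e A; have := ctrK e (f |: A).
  rewrite setUCA; have := rk_add1 rr f (e |: A); lia.
have := ctrK e A; have := ctrK e (f |: A).
have := ctrK e B; have := ctrK e (f |: B).
rewrite !(setUCA [set e]) => h1 h2 h3 h4 h.
have := @rk_cl _ _ rr f (e |: A) (e |: B) (setUS _ AB); lia.
Qed.

Lemma ctr_loop e A : r [set e] = 0%N -> ctr r e A = r A.
Proof.
move=> e0; rewrite /ctr e0 subn0; apply: rk_cl (sub0set A) _ => //.
by rewrite setU0 e0 (rk0 rr).
Qed.

Lemma dualrK E A : (dualr r E A + r E = #|A :&: E| + r (E :\: A))%N.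
Proof.
rewrite /dualr subnK //; have := rk_setD E A; rewrite setIC; lia.
Qed.

Lemma dualr_rank E : rank_fun (dualr r E).
Proof.
have DU e A : E :\: (e |: A) = (E :\: A) :\ e.
  by apply/setP=> x; rewrite !inE; case: (x == e) => //=; rewrite ?andbF.
split=> [|A B AB|e A|e A B AB].
- have := dualrK E set0; rewrite set0I cards0 setD0; lia.
- have := dualrK E A; have := dualrK E B.
  have := @rk_submod (E :\: B) (E :\: A) set0 (setDS _ AB).
  have : (r (E :\: A) <= r (E :\: B) + #|(E :\: A) :&: B|)%N.
    apply: leq_trans (rk_setD _ B) _; rewrite leq_add2r.
    by apply: (rk_mono rr); rewrite setDDl setDS // subsetUr.
  have : (#|B :&: E| = #|A :&: E| + #|(E :\: A) :&: B|)%N.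
    rewrite -(cardsID A (B :&: E)); congr (_ + _)%N; apply: eq_card => x.
      rewrite !inE; case xA: (x \in A); last by rewrite !andbF.
      by rewrite (subsetP AB _ xA) andbT.
    by rewrite !inE; case: (x \in A); case: (x \in B); case: (x \in E).
  lia.
- have := dualrK E A; have := dualrK E (e |: A).
  have : (#|(e |: A) :&: E| <= #|A :&: E|.+1)%N.
    apply: leq_trans (_ : #|e |: (A :&: E)| <= _)%N.
      by apply: subset_leq_card; apply/subsetP=> x; rewrite !inE; case: eqP.
    by rewrite cardsU1; case: (_ \notin _).
  have : (r (E :\: (e |: A)) <= r (E :\: A))%N.
    by apply: (rk_mono rr); rewrite setDS // subsetUr.
  lia.
have := dualrK E A; have := dualrK E (e |: A).
have := dualrK E B; have := dualrK E (e |: B).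
case: (boolP (e \in B)) => eB.
  by have -> : e |: B = B by apply/setUidPr; rewrite sub1set.
rewrite !DU; have := rk_setD1_le e (E :\: B).
have eA : e \notin A by apply: contra eB; apply: subsetP.
case: (boolP (e \in E)) => eE.
  have c (X : {set T}) : e \notin X -> #|(e |: X) :&: E| = #|X :&: E|.+1.
    move=> eX; rewrite setIUl cardsU; have -> : [set e] :&: E = [set e].
      by apply/setIidPl; rewrite sub1set.
    rewrite cards1 (_ : [set e] :&: (X :&: E) = set0) ?cards0 ?subn0 //.
    by apply/setP=> x; rewrite !inE; case: eqP => // ->; rewrite (negPf eX).
  rewrite !c //.
  have := @rk_dim e ((E :\: B) :\ e) ((E :\: A) :\ e).
  rewrite !setD1K ?inE ?eA ?eB //.
  have -> : (E :\: B) :\ e \subset (E :\: A) :\ e by rewrite setSD // setDS.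
  move=> /(_ isT); have := rk_setD1 e (E :\: B).
  have := rk_setD1_le e (E :\: A). lia.
have c (X : {set T}) : (e |: X) :&: E = X :&: E.
  by rewrite setIUl (_ : [set e] :&: E = set0) ?set0U //; apply/setP=> x;
     rewrite !inE; case: eqP => // ->; rewrite (negPf eE).
have d (X : {set T}) : (E :\: X) :\ e = E :\: X.
  by apply/setP=> x; rewrite !inE; case: eqP => // ->; rewrite (negPf eE) andbF.
by rewrite !c !d; lia.
Qed.

End RankFunctions.

(** * Weighted Tutte polynomials: deletion-contraction, duality, monotonicity *)

Lemma sum_subset_split (V : nmodType) (T : finType) (E : {set T}) e
    (F : {set T} -> V) : e \in E ->
  \sum_(A : {set T} | A \subset E) F A =
  \sum_(A : {set T} | A \subset E :\ e) F A +
  \sum_(A : {set T} | A \subset E :\ e) F (e |: A).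
Proof.
move=> eE; rewrite (bigID (fun A : {set T} => e \in A)) /= addrC; congr (_ + _).
  by apply: eq_bigl => A; rewrite subsetD1.
rewrite (reindex_onto (fun A => e |: A) (fun A => A :\ e)) /=; last first.
  by move=> A /andP[_ eA]; rewrite setD1K.
apply: eq_bigl => A; rewrite setU11 andbT subUset sub1set eE subsetD1 /=.
congr (_ && _); apply/eqP/idP => [<-|eA]; first by rewrite setD11.
by rewrite setU1K.
Qed.

(* The Tutte polynomial at (X, Y) of the matroid obtained from [r] on [E] by
   doubling the elements of [P] in parallel and those of [S] in series. *)
Definition tw (T : finType) (X Y : rat) (P S : {set T})
    (r : {set T} -> nat) (E : {set T}) : rat :=
  \sum_(A : {set T} | A \subset E)
    ((X - 1) ^+ (r E - r A) * (Y - 1) ^+ (#|A| - r A)) *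
    ((1 + Y) ^+ #|A :&: P| * (1 + X) ^+ #|(E :\: A) :&: S|).

Section WeightedTutte.

Variables (T : finType).
Implicit Types (A B E P S : {set T}) (e f : T) (r : {set T} -> nat) (X Y : rat).

Lemma eq_tw X Y P S r1 r2 E :
  (forall A, A \subset E -> r1 A = r2 A) -> tw X Y P S r1 E = tw X Y P S r2 E.
Proof. by move=> h; apply: eq_bigr => A AE; rewrite !h. Qed.

Lemma eq_tw_weight X Y P S P' S' r E :
  E :&: P = E :&: P' -> E :&: S = E :&: S' ->
  tw X Y P S r E = tw X Y P' S' r E.
Proof.
move=> eP eS; apply: eq_bigr => A AE; congr (_ * (_ ^+ _ * _ ^+ _)).
  by rewrite -(setIidPl AE) -!setIA eP.
by rewrite !setIDAC eS.
Qed.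

Lemma tw0 X Y P S r : tw X Y P S r set0 = 1.
Proof.
rewrite /tw (big_pred1 set0) => [|A]; last by rewrite subset0.
by rewrite subnn cards0 sub0n set0D !set0I !cards0 !expr0 !mulr1.
Qed.

Lemma cardIU1 e A P : e \notin A ->
  #|(e |: A) :&: P| = ((e \in P) + #|A :&: P|)%N.
Proof.
move=> eA; rewrite setIUl; case: (boolP (e \in P)) => eP.
  have -> : [set e] :&: P = [set e] by apply/setIidPl; rewrite sub1set.
  by rewrite cardsU1 inE (negPf eA).
rewrite (_ : [set e] :&: P = set0) ?set0U //.
by apply/setP=> x; rewrite !inE; case: eqP => // ->; rewrite (negPf eP).
Qed.

(** The exponents of X - 1 and Y - 1 are 0 or 1, being 1 exactly for a coloop and for a loop
    respectively, so one formula covers all kinds of elements. *)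
Lemma delcon X Y P S r E e : rank_fun r -> e \in E ->
  tw X Y P S r E =
  (1 + X) ^+ (e \in S) * (X - 1) ^+ (r E - r (E :\ e)) * tw X Y P S r (E :\ e)
  + (1 + Y) ^+ (e \in P) * (Y - 1) ^+ (1 - r [set e]) *
    tw X Y P S (ctr r e) (E :\ e).
Proof.
move=> rr eE; rewrite /tw (sum_subset_split _ eE) !big_distrr /=.
congr (_ + _); apply: eq_bigr => A /[dup] AE; rewrite subsetD1 => /andP[AE' eA].
  have -> : E :\: A = e |: ((E :\ e) :\: A).
    apply/setP=> x; rewrite !inE; case: (x =P e) => [->|] //=.
    by rewrite eA eE.
  rewrite cardIU1 ?inE ?eqxx ?andbF // exprD.
  have := rk_mono rr AE; have := rk_setD1_le rr e E => h1 h2.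
  have -> : (r E - r A = (r E - r (E :\ e)) + (r (E :\ e) - r A))%N by lia.
  rewrite exprD; ring.
have -> : E :\: (e |: A) = (E :\ e) :\: A by rewrite setDDl.
rewrite cardIU1 // exprD.
have h1 := ctrK rr e A; have h2 := ctrK rr e (E :\ e).
have h3 := rk1 rr e; have h4 : (ctr r e A <= #|A|)%N.
  by apply: rk_card; apply: ctr_rank.
rewrite setD1K // in h2.
have -> : (r E - r (e |: A) = ctr r e (E :\ e) - ctr r e A)%N by lia.
rewrite cardsU1 eA.
have -> : (true + #|A| - r (e |: A) = (1 - r [set e]) + (#|A| - ctr r e A))%N.
  lia.
rewrite exprD; ring.
Qed.

Lemma dualr_sub r E A : A \subset E ->
  dualr r E A = (#|A| + r (E :\: A) - r E)%N.
Proof. by move=> AE; rewrite /dualr (setIidPl AE). Qed.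

(** Complementation in [E] swaps corank with nullity and the weight on [P] with the weight on
    [S]. *)
Lemma tw_dual X Y P S r E : rank_fun r ->
  tw Y X S P (dualr r E) E = tw X Y P S r E.
Proof.
move=> rr; rewrite /tw.
rewrite (reindex_onto (fun A => E :\: A) (fun A => E :\: A)) /=; last first.
  by move=> A AE; rewrite setDDr setDv set0U (setIidPr AE).
rewrite (eq_bigl (fun A : {set T} => A \subset E)) /=; last first.
  move=> A; rewrite subsetDl /= setDDr setDv set0U.
  by apply/eqP/idP => [/setIidPr|/setIidPr].
apply: eq_bigr => A AE; rewrite setDDr setDv set0U (setIidPr AE).
have h1 := dualrK rr E E; have h2 := dualrK rr E (E :\: A).
rewrite setIid setDv (rk0 rr) in h1.
rewrite setDDr setDv set0U (setIidPr AE) (setIidPl (subsetDl _ _)) in h2.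
have h3 := rk_mono rr AE; have h4 := rk_card rr A.
have h5 : (#|E :\: A| + #|A| = #|E|)%N.
  by rewrite -(cardsID A E) (setIidPr AE) addnC.
have h6 := rk_card rr E.
have -> : (dualr r E E - dualr r E (E :\: A) = #|A| - r A)%N by lia.
have -> : (#|E :\: A| - dualr r E (E :\: A) = r E - r A)%N by lia.
ring.
Qed.

Lemma dualr_ctr r E e A : rank_fun r -> e \in E -> A \subset E :\ e ->
  dualr (ctr r e) (E :\ e) A = dualr r E A.
Proof.
move=> rr eE AE; have AE' : A \subset E := subset_trans AE (subsetDl _ _).
rewrite !dualr_sub //.
have h1 := ctrK rr e ((E :\ e) :\: A); have h2 := ctrK rr e (E :\ e).
rewrite setD1K // in h2.
have h : e |: ((E :\ e) :\: A) = E :\: A.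
  apply/setP=> x; rewrite !inE; case: (x =P e) => [->|] //=.
  by rewrite eE andbT; move: AE; rewrite subsetD1 => /andP[_ ->].
rewrite h in h1; lia.
Qed.

Lemma dualr_del r E e A : rank_fun r -> e \in E -> A \subset E :\ e ->
  ctr (dualr r E) e A = dualr r (E :\ e) A.
Proof.
move=> rr eE; rewrite subsetD1 => /andP[AE eA].
have h1 := ctrK (dualr_rank rr E) e A.
have h2 := dualrK rr E (e |: A); have h3 := dualrK rr (E :\ e) A.
have h4 := dualrK rr E [set e].
have e1 : #|(e |: A) :&: E| = #|A|.+1.
  by rewrite (setIidPl _) ?cardsU1 ?eA // subUset sub1set eE.
have e2 : #|[set e] :&: E| = 1%N by rewrite (setIidPl _) ?cards1 ?sub1set.
have e3 : #|A :&: (E :\ e)| = #|A|.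
  by rewrite (setIidPl _) // subsetD1 AE.
rewrite e1 in h2; rewrite e2 in h4; rewrite e3 in h3.
rewrite -setDDl in h2; lia.
Qed.

Lemma tw_ctr_dual X Y P S r E e : rank_fun r -> e \in E ->
  tw X Y P S (ctr r e) (E :\ e) = tw Y X S P (dualr r E) (E :\ e).
Proof.
move=> rr eE; rewrite -(tw_dual _ _ _ _ _ (ctr_rank rr e)).
by apply: eq_tw => A AE; apply: dualr_ctr.
Qed.

Lemma tw_del_dual X Y P S r E e : rank_fun r -> e \in E ->
  tw X Y P S r (E :\ e) = tw Y X S P (ctr (dualr r E) e) (E :\ e).
Proof.
move=> rr eE; rewrite -(tw_dual _ _ _ _ _ rr).
by apply: eq_tw => A AE; rewrite dualr_del.
Qed.

Lemma ctrC r e f A : rank_fun r -> ctr (ctr r e) f A = ctr (ctr r f) e A.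
Proof.
move=> rr; rewrite /ctr setUCA (setUC [set f] [set e]).
have := rk_mono rr (subsetUl [set e] (f |: A)).
have := rk_mono rr (subsetUl [set f] (e |: A)).
have := rk_mono rr (subsetUl [set e] [set f]).
have := rk_mono rr (subsetUr [set e] [set f]).
rewrite (setUCA [set f]); lia.
Qed.

Lemma ctr_coloop r E f A : rank_fun r -> f \in E -> (r (E :\ f) < r E)%N ->
  A \subset E :\ f -> ctr r f A = r A.
Proof.
move=> rr fE clf AE; have := rk_dim rr f AE; rewrite setD1K //.
have := ctrK rr f A; have := rk_add1 rr f A; have := rk1 rr f.
have := rk_add1 rr f set0; have := rk_submod rr [set f] (sub0set A).
rewrite setU0 (rk0 rr); lia.
Qed.

(* Expand both sides at an element [f] of [E]: contracting [e] creates no coloop,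
   so the deletion term never has a worse sign on the right. *)
Lemma tw02_ctr P S r E e : rank_fun r ->
  0 <= tw 0 2 P S r E /\ tw 0 2 P S r E <= tw 0 2 P S (ctr r e) E.
Proof.
have [n] := ubnP #|E|; elim: n => // n IH in E r e *; move=> lt_E rr.
have [->|[f fE]] := set_0Vmem E; first by rewrite !tw0.
have lt_Ef : (#|E :\ f| < n)%N by move: lt_E; rewrite (cardsD1 f E) fE.
have rre := ctr_rank rr e; have rrf := ctr_rank rr f.
have [p1 m1] := IH (E :\ f) r e lt_Ef rr.
have [_ m1'] := IH (E :\ f) r f lt_Ef rr.
have [p2 m2] := IH (E :\ f) (ctr r f) e lt_Ef rrf.
have [p3 m3] := IH (E :\ f) (ctr r e) f lt_Ef rre.
have eC : tw 0 2 P S (ctr (ctr r f) e) (E :\ f) =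
          tw 0 2 P S (ctr (ctr r e) f) (E :\ f).
  by apply: eq_tw => A _; apply: ctrC.
rewrite eC in m2.
rewrite !(delcon _ _ _ _ _ fE) //.
have -> : (1 + 0 : rat) = 1 by [].
(* At Y = 2 loops have factor 1; only a coloop, with X - 1 = -1, brings a sign. *)
have -> : (2 - 1 : rat) = 1 by [].
have -> : (0 - 1 : rat) = -1 by [].
rewrite !expr1n !mul1r !mulr1.
have w1 : 1 <= (1 + 2 : rat) ^+ (f \in P) by case: (f \in P).
set w := (1 + 2 : rat) ^+ (f \in P) in w1 *.
have h1 := rk_setD1 rr f E; have h2 := rk_setD1 rre f E.
have h3 := rk_setD1_le rr f E; have h4 := rk_setD1_le rre f E.
have h5 : (ctr r e E + r (E :\ f) <= r E + ctr r e (E :\ f))%N.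
  have := ctrK rr e E; have := ctrK rr e (E :\ f).
  have := rk_dim rr f (subsetUr [set e] (E :\ f)).
  rewrite setUCA setD1K //; lia.
have mw (a b : rat) : a <= b -> w * a <= w * b by move=> ab; apply: ler_wpM2l; lra.
have mw1 (a : rat) : 0 <= a -> a <= w * a by move=> a0; rewrite ler_peMl.
have := mw _ _ m2; have := mw1 _ p2; have := mw1 _ p3.
(* By [h5] a coloop [f] of the contraction is already a coloop before it, which rules out the fourth
   combination. Where [f] is a coloop, contracting it equals deleting it ([ef], [eg]), and w >= 1
   absorbs the negative term. *)
have [[d1 d2]|[[d1 d2]|[d1 d2]]] :
    ((ctr r e E - ctr r e (E :\ f) = 0 /\ r E - r (E :\ f) = 0) \/
     (ctr r e E - ctr r e (E :\ f) = 0 /\ r E - r (E :\ f) = 1) \/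
     (ctr r e E - ctr r e (E :\ f) = 1 /\ r E - r (E :\ f) = 1))%N.
- by clear -h1 h2 h3 h4 h5; lia.
- rewrite d1 d2 !expr0; split; lra.
all: have ef : tw 0 2 P S (ctr r f) (E :\ f) = tw 0 2 P S r (E :\ f)
  by apply: eq_tw => A AE; apply: ctr_coloop AE => //; clear -d2; lia.
- by rewrite d1 d2 expr0 expr1 ef; rewrite ef in m1' *; split; lra.
have eg : tw 0 2 P S (ctr (ctr r e) f) (E :\ f) = tw 0 2 P S (ctr r e) (E :\ f).
  by apply: eq_tw => A AE; apply: ctr_coloop AE => //; clear -d1; lia.
rewrite d1 d2 expr1 ef eg !mulN1r.
have := mw1 (tw 0 2 P S (ctr r e) (E :\ f) - tw 0 2 P S r (E :\ f)).
by rewrite mulrBr; split; lra.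
Qed.

Lemma tw20_ctr P S r E e : rank_fun r -> e \in E ->
  0 <= tw 2 0 P S (ctr r e) (E :\ e) /\
  tw 2 0 P S (ctr r e) (E :\ e) <= tw 2 0 P S r (E :\ e).
Proof.
move=> rr eE; rewrite (tw_ctr_dual 2 0 P S rr eE) (tw_del_dual 2 0 P S rr eE).
by apply: tw02_ctr; apply: dualr_rank.
Qed.

Lemma tw02_ge0 P S r E : rank_fun r -> 0 <= tw 0 2 P S r E.
Proof.
move=> rr; have [->|[e _]] := set_0Vmem E; first by rewrite tw0.
by have [] := tw02_ctr P S E e rr.
Qed.

Lemma tw20_ge0 P S r E : rank_fun r -> 0 <= tw 2 0 P S r E.
Proof.
by move=> rr; rewrite -(tw_dual _ _ _ _ _ rr); apply/tw02_ge0/dualr_rank.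
Qed.

Lemma tw11_ge0 P S r E : 0 <= tw 1 1 P S r E.
Proof.
apply: sumr_ge0 => A _; rewrite subrr; do !apply: mulr_ge0.
all: by apply: exprn_ge0.
Qed.

End WeightedTutte.

(* The doubled matroid has neither loops nor coloops. *)
Definition valid (T : finType) (P S : {set T}) (r : {set T} -> nat)
    (E : {set T}) : Prop :=
  forall e, e \in E ->
    (r [set e] = 0%N -> e \in S) /\ ((r (E :\ e) < r E)%N -> e \in P).

(** * Ratio bounds and the numerical inequalities behind the reductions *)

Definition ratio_ge (T : finType) (g : rat) (P S : {set T})
    (r : {set T} -> nat) (E : {set T}) : Prop :=
  g * tw 1 1 P S r E ^+ 2 <= tw 2 0 P S r E * tw 0 2 P S r E.


(** For a second pair in a parallel class: T(2,0) stays the same, T(0,2) grows at least fourfold and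
    T(1,1) at most twofold, so the ratio cannot fall. *)
Lemma par_par_ineq (g p q a c t : rat) : 0 <= g -> 0 <= p -> 0 <= t ->
  q <= 4 * c -> 2 * t <= a -> g * a ^+ 2 <= p * q ->
  g * (a + 2 * t) ^+ 2 <= p * (q + 12 * c).
Proof.
move=> g0 p0 t0 qc ta h.
have h1 : (a + 2 * t) ^+ 2 <= 4 * a ^+ 2 by nra.
have h2 := ler_wpM2l g0 h1.
have h3 : p * (4 * q) <= p * (q + 12 * c) by apply: ler_wpM2l => //; lra.
lra.
Qed.

(* The ratio 6/5 lets the AM-GM bound 4 d c <= (9/5) d^2 + (20/9) c^2 close
   the estimate. *)
Lemma par_step_ineq (g D' C' D C d c : rat) : 0 <= g -> 0 <= C' -> C' <= D' ->
  0 <= D -> D <= C -> g * d ^+ 2 <= D' * D ->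
  6%:R / 5%:R * g * c ^+ 2 <= C' * C ->
  g * (d + 2 * c) ^+ 2 <= (D' + C') * (D + 3 * C).
Proof.
move=> g0 c0 cd d0 dc h1 h2.
have h3 : (d + 2 * c) ^+ 2 <= 14%:R / 5%:R * d ^+ 2 + 56%:R / 9%:R * c ^+ 2.
  have := sqr_ge0 (d * 9%:R - c * 10%:R); nra.
have h4 := ler_wpM2l g0 h3.
(* 140/27 is 56/9 divided by 6/5. The bound is nearly tight: for D' = C' and D = C it compares 14/5
   + 140/27 = 1078/135 with 8. *)
have h5 : 14%:R / 5%:R * (D' * D) + 140%:R / 27%:R * (C' * C) <=
    (D' + C') * (D + 3 * C).
  have u0 : 0 <= D' - C' by lra.
  have v0 : 0 <= C - D by lra.
  have := mulr_ge0 u0 v0; have := mulr_ge0 u0 d0; have := mulr_ge0 c0 v0.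
  have := mulr_ge0 c0 d0; lra.
lra.
Qed.

(** Cauchy-Schwarz without square roots: the cross term 2dc is compared with D'C + C'D through their
    squares. *)
Lemma single_step_ineq (D' C' D C d c : rat) : 0 <= C' -> 0 <= D' ->
  0 <= D -> 0 <= C -> 0 <= d -> 0 <= c -> d ^+ 2 <= D' * D ->
  c ^+ 2 <= C' * C -> (d + c) ^+ 2 <= (D' + C') * (D + C).
Proof.
move=> c'0 d'0 D0 C0 d0 c0 h1 h2.
have h3 : (2 * (d * c)) ^+ 2 <= (D' * C + C' * D) ^+ 2.
  have := @ler_pM _ _ _ _ _ (sqr_ge0 d) (sqr_ge0 c) h1 h2.
  have := sqr_ge0 (D' * C - C' * D); nra.
have h4 : 2 * (d * c) <= D' * C + C' * D.
  by rewrite -ler_sqr ?nnegrE ?addr_ge0 ?mulr_ge0.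
nra.
Qed.

Lemma triple_step_ineq (d c p q C C' : rat) : 0 <= d -> 0 <= c -> 0 <= p ->
  0 <= C -> 0 <= C' -> q <= 4 * C -> 2 * C' <= p -> d ^+ 2 <= p * q ->
  c ^+ 2 <= C' * C -> (d + c) ^+ 2 <= p * (q + 4 * C).
Proof.
move=> d0 c0 p0 C0 C'0 qC Cp h1 h2.
have h3 : 2 * C' * C <= p * C by apply: ler_wpM2r.
have h4 : p * q <= p * (4 * C) by apply: ler_wpM2l.
(* As c^2 <= pC/2, it is enough that 2dc <= 7/2 pC. If 2d <= 7c this follows from 2dc <= 7c^2;
   otherwise c < 2d/7, and d^2 <= 4pC makes 2dc + c^2 at most 4pC. *)
have [le|lt] := lerP (2 * d) (7%:R * c); nra.
Qed.

(** * Effect of local configurations on the ratio *)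

Section Reductions.

Variables (T : finType) (P S : {set T}).
Implicit Types (A B E : {set T}) (e f : T) (r : {set T} -> nat) (g : rat).

Lemma ratio_ge_le g g' r E : g <= g' -> ratio_ge g' P S r E -> ratio_ge g P S r E.
Proof.
by move=> gg'; apply: le_trans; apply: ler_wpM2r => //; apply: sqr_ge0.
Qed.

Lemma par_ctr r e f A : rank_fun r -> r [set e] = 1%N -> r [set f] = 1%N ->
  r [set e; f] = 1%N -> ctr r e A = ctr r f A.
Proof.
move=> rr e1 f1 ef; rewrite /ctr e1 f1; congr (_ - _)%N.
have h1 : r (e |: (f |: A)) = r (f |: A).
  apply: (rk_cl rr (subsetUl [set f] A)); by rewrite ef f1.
have h2 : r (f |: (e |: A)) = r (e |: A).
  apply: (rk_cl rr (subsetUl [set e] A)); by rewrite setUC ef e1.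
by rewrite -h1 -h2 setUCA.
Qed.

Lemma par_ctr_loop r e f : r [set e] = 1%N -> r [set e; f] = 1%N ->
  ctr r e [set f] = 0%N.
Proof. by move=> e1 ef; rewrite /ctr ef e1. Qed.

Lemma par_noncoloop r E e f : rank_fun r -> e != f -> e \in E ->
  r [set e] = 1%N -> r [set e; f] = 1%N -> f \in E -> r (E :\ f) = r E.
Proof.
move=> rr nef eE e1 ef fE; rewrite -{2}(setD1K fE); symmetry.
apply: (rk_cl rr (A := [set e])); last by rewrite setUC ef e1.
by rewrite sub1set !inE nef.
Qed.

Lemma tw_reg X Y r E e : rank_fun r -> e \in E -> r [set e] = 1%N ->
  r (E :\ e) = r E ->
  tw X Y P S r E = (1 + X) ^+ (e \in S) * tw X Y P S r (E :\ e) +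
    (1 + Y) ^+ (e \in P) * tw X Y P S (ctr r e) (E :\ e).
Proof.
by move=> rr eE e1 eE1; rewrite (delcon _ _ _ _ rr eE) e1 eE1 !subnn !expr0 !mulr1.
Qed.

Lemma tw_loop X Y r E e : rank_fun r -> e \in E -> r [set e] = 0%N ->
  tw X Y P S r E = ((1 + X) ^+ (e \in S) + (1 + Y) ^+ (e \in P) * (Y - 1)) *
    tw X Y P S r (E :\ e).
Proof.
move=> rr eE e0; rewrite (delcon _ _ _ _ rr eE) e0.
rewrite (eq_tw _ _ _ _ (r2 := r)) => [|A _]; last exact: ctr_loop.
have -> : r (E :\ e) = r E.
  by have := ctr_loop rr (E :\ e) e0; rewrite /ctr setD1K // e0 subn0.
by rewrite subnn expr0 subn0 expr1; ring.
Qed.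

Lemma tw_coloop X Y r E e : rank_fun r -> e \in E -> (r (E :\ e) < r E)%N ->
  tw X Y P S r E = ((1 + X) ^+ (e \in S) * (X - 1) + (1 + Y) ^+ (e \in P)) *
    tw X Y P S r (E :\ e).
Proof.
move=> rr eE cle; rewrite (delcon _ _ _ _ rr eE).
rewrite (eq_tw _ _ _ _ (r1 := ctr r e) (r2 := r)) => [|A AE]; last first.
  exact: ctr_coloop AE.
have -> : r [set e] = 1%N.
  have := ctr_coloop rr eE cle (subxx _); have := ctrK rr e (E :\ e).
  by rewrite setD1K //; have := rk_setD1 rr e E; lia.
have -> : (r E - r (E :\ e) = 1)%N by have := rk_setD1 rr e E; lia.
by rewrite subnn expr0 expr1; ring.
Qed.

Hypothesis PS : [disjoint P & S].

Lemma notS e : e \in P -> (e \in S) = false.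
Proof. by move=> eP; apply: disjointFr PS eP. Qed.

Lemma notP e : e \in S -> (e \in P) = false.
Proof. by move=> eS; apply: disjointFl PS eS. Qed.

(** Such a pair has factor (X - 1) + (1 + Y) = X + Y, which is 2 at each of the three points. *)
Lemma ratio_ge_coloop g r E e : rank_fun r -> e \in E -> e \in P ->
  (r (E :\ e) < r E)%N -> ratio_ge g P S r (E :\ e) -> ratio_ge g P S r E.
Proof.
move=> rr eE eP cle; rewrite /ratio_ge !(tw_coloop _ _ rr eE cle) eP notS // => h.
rewrite !expr0 !expr1; lra.
Qed.

(** Contracting [f] turns the pair [e] into two loops, of factor Y^2, so the contraction term
    carries (1 + Y) Y^2: this is 0, 12 and 2 at Y = 0, 2 and 1. The two inequalities come from
    expanding [E :\ f] at [e]. *)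
Lemma tw_par_par r E e f : rank_fun r -> e != f -> e \in E -> f \in E ->
  e \in P -> f \in P -> r [set e] = 1%N -> r [set f] = 1%N ->
  r [set e; f] = 1%N ->
  let C0 := tw 0 2 P S (ctr r f) (E :\ f :\ e) in
  let t0 := tw 1 1 P S (ctr r f) (E :\ f :\ e) in
  [/\ tw 2 0 P S r E = tw 2 0 P S r (E :\ f),
      tw 0 2 P S r E = tw 0 2 P S r (E :\ f) + 12 * C0,
      tw 0 2 P S r (E :\ f) <= 4 * C0,
      tw 1 1 P S r E = tw 1 1 P S r (E :\ f) + 2 * t0
    & 2 * t0 <= tw 1 1 P S r (E :\ f)].
Proof.
move=> rr nef eE fE eP fP e1 f1 ef C0 t0.
have ncf := par_noncoloop rr nef eE e1 ef fE.
have efE : e \in E :\ f by rewrite !inE nef.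
have rrf := ctr_rank rr f.
have le0 : ctr r f [set e] = 0%N by apply: par_ctr_loop; rewrite // setUC.
rewrite !(tw_reg _ _ rr fE f1 ncf) !(tw_loop _ _ rrf efE le0).
rewrite eP fP (notS eP) (notS fP) !expr0 !expr1 -/C0 -/t0.
have eC X Y : tw X Y P S (ctr r e) (E :\ f :\ e) =
    tw X Y P S (ctr r f) (E :\ f :\ e).
  by apply: eq_tw => A _; apply: par_ctr.
have [_] := tw02_ctr P S (E :\ f :\ e) e rr; rewrite eC -/C0 => leC.
have [D0 _] := tw02_ctr P S (E :\ f :\ e) e rr.
have dE : tw 0 2 P S r (E :\ f) <= 4 * C0 /\ 2 * t0 <= tw 1 1 P S r (E :\ f).
  rewrite !(delcon _ _ _ _ rr efE) eP notS // !eC -/C0 -/t0 e1 subnn !expr0.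
  have := tw11_ge0 P S r (E :\ f :\ e).
  have := rk_setD1 rr e (E :\ f); have := rk_setD1_le rr e (E :\ f).
  have [->|->] : (r (E :\ f) - r (E :\ f :\ e) = 0 \/
           r (E :\ f) - r (E :\ f :\ e) = 1)%N.
  - by have := rk_setD1 rr e (E :\ f); lia.
  - by rewrite expr0; split; lra.
  by rewrite expr1; split; lra.
case: dE => d1 d2; split=> //; lra.
Qed.

Lemma ratio_ge_par_par g r E e f : rank_fun r -> e != f -> e \in E -> f \in E ->
  e \in P -> f \in P -> r [set e] = 1%N -> r [set f] = 1%N ->
  r [set e; f] = 1%N -> 0 <= g ->
  ratio_ge g P S r (E :\ f) -> ratio_ge g P S r E.
Proof.
move=> rr nef eE fE eP fP e1 f1 ef g0.
have := tw_par_par rr nef eE fE eP fP e1 f1 ef.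
have t0 := tw11_ge0 P S (ctr r f) (E :\ f :\ e).
have p0 := tw20_ge0 P S (E :\ f) rr.
move=> /= [h1 h2 h3 h4 h5]; rewrite /ratio_ge h1 h2 h4.
exact: par_par_ineq.
Qed.

(* Here e and f form a triangle with one edge doubled: T(2,0) = T(0,2) = 6
   and T(1,1) = 5. *)
Lemma ratio_ge_triangle g r E e f : rank_fun r -> e \in E -> f \in E ->
  e \in P -> f \in S -> r [set e] = 1%N -> r [set f] = 1%N ->
  r [set e; f] = 1%N -> r (E :\ e) = r E -> (r (E :\ e :\ f) < r (E :\ e))%N ->
  ratio_ge g P S (ctr r e) (E :\ e) -> ratio_ge (36%:R / 25%:R * g) P S r E.
Proof.
move=> rr eE fE eP fS e1 f1 ef nce clf.
have fEe : f \in E :\ e.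
  by rewrite !inE fE andbT; apply/eqP=> fe; move: fS; rewrite fe notS.
have rre := ctr_rank rr e.
have lf0 : ctr r e [set f] = 0%N by apply: par_ctr_loop.
rewrite /ratio_ge !(tw_reg _ _ rr eE e1 nce) !(tw_loop _ _ rre fEe lf0).
rewrite !(tw_coloop _ _ rr fEe clf) (notP fS) fS (notS eP) eP.
(* [f] is parallel to [e] and a coloop once [e] is deleted, so contracting [e] and removing [f]
   equals deleting both. All values become multiples of one common value Z: X^2 + (1 + Y)(X + Y) for
   the whole, X + Y for the contraction. *)
have eZ X Y : tw X Y P S (ctr r e) (E :\ e :\ f) = tw X Y P S r (E :\ e :\ f).
  apply: eq_tw => A AE; rewrite (par_ctr _ rr e1 f1 ef).
  exact: ctr_coloop AE.
rewrite !eZ; move: (tw 1 1 _ _ _ _) (tw 2 0 _ _ _ _) (tw 0 2 _ _ _ _) => a b c.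
rewrite !expr0 !expr1; nra.
Qed.

Lemma ratio_ge_par_step g r E e : rank_fun r -> e \in E -> e \in P ->
  r [set e] = 1%N -> r (E :\ e) = r E -> 0 <= g ->
  ratio_ge g P S r (E :\ e) -> ratio_ge (6%:R / 5%:R * g) P S (ctr r e) (E :\ e) ->
  ratio_ge g P S r E.
Proof.
move=> rr eE eP e1 nce g0.
have [d1 d2] := tw20_ctr P S rr eE; have [c1 c2] := tw02_ctr P S (E :\ e) e rr.
have td := tw11_ge0 P S r (E :\ e); have tc := tw11_ge0 P S (ctr r e) (E :\ e).
rewrite /ratio_ge !(tw_reg _ _ rr eE e1 nce) notS // eP !expr0 !expr1 => h1 h2.
have := par_step_ineq g0 d1 d2 c1 c2 h1 h2; lra.
Qed.

Lemma ratio_ge_single_step r E e : rank_fun r -> e \in E -> e \notin P ->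
  e \notin S -> r [set e] = 1%N -> r (E :\ e) = r E ->
  ratio_ge 1 P S r (E :\ e) -> ratio_ge 1 P S (ctr r e) (E :\ e) ->
  ratio_ge 1 P S r E.
Proof.
move=> rr eE /negPf eP /negPf eS e1 nce.
have [d1 d2] := tw20_ctr P S rr eE; have [c1 c2] := tw02_ctr P S (E :\ e) e rr.
have td := tw11_ge0 P S r (E :\ e); have tc := tw11_ge0 P S (ctr r e) (E :\ e).
rewrite /ratio_ge !(tw_reg _ _ rr eE e1 nce) eP eS !expr0 !mul1r => h1 h2.
by apply: single_step_ineq; rewrite // (le_trans _ d2, le_trans _ c2).
Qed.

(** [e] and the pair [f] are three parallel elements. After contracting [e] the pair is two loops of
    factor Y^2, that is 0, 4 and 1 at the three points, so adding [e] leaves T(2,0) unchanged. *)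
Lemma ratio_ge_triple_step r E e f : rank_fun r -> e \in E -> f \in E ->
  e \notin P -> e \notin S -> f \in P -> r [set e] = 1%N -> r [set f] = 1%N ->
  r [set e; f] = 1%N -> ratio_ge 1 P S r (E :\ e) ->
  ratio_ge 1 P S (ctr r e) (E :\ e :\ f) -> ratio_ge 1 P S r E.
Proof.
move=> rr eE fE eP eS fP e1 f1 ef.
have nfe : f != e by apply: contraNneq eP => <-.
have fEe : f \in E :\ e by rewrite !inE nfe.
have nce : r (E :\ e) = r E by apply: par_noncoloop nfe fE f1 _ eE => //; rewrite setUC.
have rre := ctr_rank rr e.
have lf0 : ctr r e [set f] = 0%N by apply: par_ctr_loop.
have fN : f \in S = false by rewrite notS.
have eC X Y : tw X Y P S (ctr r f) (E :\ e :\ f) =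
    tw X Y P S (ctr r e) (E :\ e :\ f).
  by apply: eq_tw => A _; rewrite (par_ctr _ rr e1 f1 ef).
have td := tw11_ge0 P S r (E :\ e); have tc := tw11_ge0 P S (ctr r e) (E :\ e :\ f).
have c0 := tw20_ge0 P S (E :\ e :\ f) rre.
have C0 := tw02_ge0 P S (E :\ e :\ f) rre.
have p0 := tw20_ge0 P S (E :\ e) rr.
have [_] := tw02_ctr P S (E :\ e :\ f) f rr; rewrite eC => CD.
have D0 := tw02_ge0 P S (E :\ e :\ f) rr.
have [_] := tw20_ctr P S rr fEe; rewrite eC => cd.
rewrite /ratio_ge !(tw_reg _ _ rr eE e1 nce) !(tw_loop _ _ rre fEe lf0).
rewrite (negPf eP) (negPf eS) fN fP !expr0 !mul1r !expr1 => h1 h2.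
have [q1 q2] : tw 0 2 P S r (E :\ e) <= 4 * tw 0 2 P S (ctr r e) (E :\ e :\ f) /\
    2 * tw 2 0 P S (ctr r e) (E :\ e :\ f) <= tw 2 0 P S r (E :\ e).
  have ctrE X Y := delcon X Y P S rr fEe.
  rewrite !ctrE fN fP !eC f1 subnn !expr0 !mul1r !mulr1.
  have := rk_setD1 rr f (E :\ e); have := rk_setD1_le rr f (E :\ e).
  clear -cd CD D0 C0 => a b.
  have [->|->] : (r (E :\ e) - r (E :\ e :\ f) = 0 \/
           r (E :\ e) - r (E :\ e :\ f) = 1)%N by lia.
    by rewrite !expr0; split; lra.
  by rewrite !expr1; split; lra.
have := triple_step_ineq td tc p0 C0 c0 q1 q2 h1 h2; lra.
Qed.

(** Once [f] is contracted, [e] is a loop of factor Y; the weights 1 and Y of the two terms add up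
    to 1 + Y, the weight of a pair. *)
Lemma tw_merge X Y r E e f : rank_fun r -> e != f -> e \in E -> f \in E ->
  e \notin P -> e \notin S -> f \notin P -> f \notin S -> r [set e] = 1%N ->
  r [set f] = 1%N -> r [set e; f] = 1%N ->
  tw X Y (e |: P) S r (E :\ f) = tw X Y P S r E.
Proof.
move=> rr nef eE fE eP eS fP fS e1 f1 ef.
have ncf := par_noncoloop rr nef eE e1 ef fE.
have efE : e \in E :\ f by rewrite !inE nef.
have rrf := ctr_rank rr f.
have le0 : ctr r f [set e] = 0%N by apply: par_ctr_loop; rewrite // setUC.
rewrite (tw_reg _ _ rr fE f1 ncf) (tw_loop _ _ rrf efE le0).
rewrite !(delcon _ _ _ _ rr efE) setU11 (negPf eS) (negPf eP) (negPf fS) (negPf fP).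
have w0 r' : tw X Y (e |: P) S r' (E :\ f :\ e) = tw X Y P S r' (E :\ f :\ e).
  apply: eq_tw_weight => //; apply/setP=> x; rewrite !inE.
  by case: (x == e).
have eC : tw X Y P S (ctr r e) (E :\ f :\ e) = tw X Y P S (ctr r f) (E :\ f :\ e).
  by apply: eq_tw => A _; apply: par_ctr.
rewrite !w0 !eC e1 subnn !expr0 expr1; ring.
Qed.

End Reductions.

(** * Closed formulas for pairs that are free, loops, a circuit or one parallel class *)

Section Explicit.

Variables (T : finType) (P S : {set T}).
Hypothesis PS : [disjoint P & S].
Implicit Types (A B E F : {set T}) (e f : T) (r : {set T} -> nat).

Lemma rk_indep_sub r E F : rank_fun r -> F \subset E -> r E = #|E| ->
  r F = #|F|.
Proof.
move=> rr FE rE; have := rk_setU rr F (E :\: F).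
rewrite -{1}(setIidPr FE) setID rE; have := rk_card rr F.
by have := cardsID F E; rewrite (setIidPr FE); lia.
Qed.

Lemma tw_free r F X Y : rank_fun r -> F \subset P -> r F = #|F| ->
  tw X Y P S r F = (X + Y) ^+ #|F|.
Proof.
move=> rr; elim/(@set_ind T): F => [|e F eF IH] FP rF.
  by rewrite tw0 cards0.
have eE : e \in e |: F by rewrite setU11.
have eK : (e |: F) :\ e = F by rewrite setU1K.
have eP : e \in P by apply: (subsetP FP).
have rF' : r F = #|F| by apply: rk_indep_sub rF; rewrite ?subsetUr.
rewrite (tw_coloop P S _ _ rr eE) eK; last by rewrite rF rF' cardsU1 eF.
rewrite IH //; last by apply: subset_trans FP; apply: subsetUr.
by rewrite (notS PS eP) eP !expr0 !expr1 cardsU1 eF exprS; ring.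
Qed.

Lemma tw_loops r F X Y : rank_fun r -> F \subset P -> r F = 0%N ->
  tw X Y P S r F = (Y ^+ 2) ^+ #|F|.
Proof.
move=> rr; elim/(@set_ind T): F => [|e F eF IH] FP rF.
  by rewrite tw0 cards0.
have eE : e \in e |: F by rewrite setU11.
have eK : (e |: F) :\ e = F by rewrite setU1K.
have eP : e \in P by apply: (subsetP FP).
have rF' : r F = 0%N by have := rk_mono rr (subsetUr [set e] F); lia.
have re : r [set e] = 0%N by have := rk_mono rr (subsetUl [set e] F); lia.
rewrite (tw_loop P S _ _ rr eE re) eK IH //; last first.
  by apply: subset_trans FP; apply: subsetUr.
by rewrite (notS PS eP) eP !expr0 !expr1 cardsU1 eF (exprS (Y ^+ 2)); ring.
Qed.

(** Contracting a pair leaves a shorter circuit; deleting it leaves coloop pairs, each of factor X +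
    Y. The last identity is doubled to keep the induction free of halves. *)
Lemma tw_circuit r E : rank_fun r -> E \subset P -> (r E).+1 = #|E| ->
  (forall e, e \in E -> r (E :\ e) = r E) ->
  [/\ tw 2 0 P S r E = 2 ^+ #|E| - 2,
      tw 0 2 P S r E = 2 * 3 ^+ #|E| - 2 ^+ #|E|
    & 2 * tw 1 1 P S r E = #|E|%:R * 2 ^+ #|E|].
Proof.
have [n] := ubnP #|E|; elim: n => // n IH in r E *; move=> lt_E rr EP rE nc.
have [e eE] : exists e, e \in E by apply/card_gt0P; lia.
have eP : e \in P by apply: (subsetP EP).
have cE : #|E| = #|E :\ e|.+1 by rewrite (cardsD1 e E) eE.
have [F0|[f fF]] := set_0Vmem (E :\ e).
  have E1 : E = [set e] by rewrite -(setD1K eE) F0 setU0.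
  have re : r [set e] = 0%N by rewrite -E1; move: rE; rewrite cE F0 cards0; lia.
  rewrite !(tw_loop P S _ _ rr eE re) F0 !tw0 cE F0 cards0 (notS PS eP) eP.
  by rewrite !expr0 !expr1; split; lra.
have fE : f \in E by move: fF; rewrite inE => /andP[].
have iD x : x \in E -> r (E :\ x) = #|E :\ x|.
  by move=> xE; rewrite nc //; move: rE; rewrite (cardsD1 x E) xE; lia.
have e1 : r [set e] = 1%N.
  rewrite -(cards1 e); apply: rk_indep_sub (iD f fE) => //.
  by rewrite sub1set !inE eE andbT; move: fF; rewrite !inE eq_sym => /andP[].
have rre := ctr_rank rr e.
have EP' : E :\ e \subset P by apply: subset_trans EP; apply: subsetDl.
have ce := ctrK rr e (E :\ e); rewrite setD1K // e1 in ce.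
have [] := IH (ctr r e) (E :\ e) _ rre EP'; first by lia.
- by move: rE; lia.
- move=> x xE; have := ctrK rr e (E :\ e :\ x).
  have [nxe xE'] : x != e /\ x \in E by move: xE; rewrite !inE => /andP[].
  have -> : e |: (E :\ e :\ x) = E :\ x.
    by apply/setP=> y; rewrite !inE; case: (y =P e) => [->|] //=;
       rewrite eE eq_sym nxe.
  by rewrite nc // e1; move: ce; clear; lia.
rewrite !(tw_reg P S _ _ rr eE e1 (nc _ eE)) (notS PS eP) eP !expr0 !expr1.
rewrite !(tw_free _ _ rr EP' (iD _ eE)) cE => -> h2 h3.
have -> : (2 + 0 : rat) = 2 by [].
have -> : (0 + 2 : rat) = 2 by [].
have -> : (1 + 1 : rat) = 2 by [].
rewrite h2 -natr1 !(exprS _ #|E :\ e|).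
by split; lra.
Qed.

(** Contracting a pair turns all others into loops, with factor Y^2 each; at Y = 0 this vanishes
    unless no pair is left. *)
Lemma tw_line r E : rank_fun r -> E \subset P -> r E = 1%N ->
  (forall e, e \in E -> r [set e] = 1%N) ->
  [/\ tw 2 0 P S r E = 2, tw 0 2 P S r E = 4 ^+ #|E| - 2
    & tw 1 1 P S r E = 2 * #|E|%:R].
Proof.
have [n] := ubnP #|E|; elim: n => // n IH in r E *; move=> lt_E rr EP rE nl.
have [e eE] : exists e, e \in E.
  by apply/set0Pn; apply/eqP=> E0; move: rE; rewrite E0 (rk0 rr).
have eP : e \in P by apply: (subsetP EP).
have cE : #|E| = #|E :\ e|.+1 by rewrite (cardsD1 e E) eE.
have [F0|[f fF]] := set_0Vmem (E :\ e).
  have E1 : E = [set e] by rewrite -(setD1K eE) F0 setU0.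
  have rE' : r E = #|E| by rewrite rE cE F0 cards0.
  by rewrite !(tw_free _ _ rr EP rE') cE F0 cards0 !expr1; split; lra.
have fE : f \in E by move: fF; rewrite inE => /andP[].
have rre := ctr_rank rr e.
have EP' : E :\ e \subset P by apply: subset_trans EP; apply: subsetDl.
have rF : r (E :\ e) = 1%N.
  have := rk_setD1_le rr e E; have f1 := nl _ fE.
  have : [set f] \subset E :\ e by rewrite sub1set.
  by move=> /(rk_mono rr); lia.
have ce : ctr r e (E :\ e) = 0%N.
  by have := ctrK rr e (E :\ e); rewrite setD1K // nl //; lia.
have nce : r (E :\ e) = r E by rewrite rF.
have [||h20 h02 h11] := IH r (E :\ e) _ rr EP' rF; first by lia.
  by move=> x; rewrite inE => /andP[_]; apply: nl.
rewrite !(tw_reg P S _ _ rr eE (nl _ eE) nce) (notS PS eP) eP !expr0 !expr1.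
rewrite !(tw_loops _ _ rre EP' ce) h20 h02 h11 cE -natr1 (exprS _ #|E :\ e|).
have -> : (0 ^+ 2 : rat) ^+ #|E :\ e| = 0.
  by rewrite expr0n /= expr0n (cardsD1 f) fF.
have -> : (2 ^+ 2 : rat) = 4 by [].
by rewrite expr1n expr1n; split; lra.
Qed.

End Explicit.

(** * Duality and the rank of the pairs *)

Section Duality.

Variable T : finType.
Implicit Types (A B E P S : {set T}) (e f : T) (r : {set T} -> nat).

Lemma dualrE r E : rank_fun r -> (dualr r E E + r E = #|E|)%N.
Proof. by move=> rr; rewrite dualrK // setIid setDv (rk0 rr) addn0. Qed.

Lemma dualr1 r E e : rank_fun r -> e \in E ->
  (dualr r E [set e] + r E = (r (E :\ e)).+1)%N.
Proof.
by move=> rr eE; rewrite dualrK // (setIidPl _) ?sub1set // cards1.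
Qed.

Lemma dualrD1 r E e : rank_fun r -> e \in E ->
  ((dualr r E (E :\ e) + r E).+1 = #|E| + r [set e])%N.
Proof.
move=> rr eE; rewrite dualrK // (setIidPl _) ?subsetDl // (cardsD1 e E) eE.
by rewrite setDDr setDv set0U (setIidPr _) ?sub1set.
Qed.

Lemma dualr2 r E e f : rank_fun r -> e != f -> e \in E -> f \in E ->
  (dualr r E [set e; f] + r E = (r (E :\ e :\ f)).+2)%N.
Proof.
move=> rr ef eE fE; rewrite dualrK // (setIidPl _); last first.
  by rewrite subUset !sub1set eE.
by rewrite cards2 ef setDDl.
Qed.

Lemma dualrr r E A : rank_fun r -> A \subset E -> dualr (dualr r E) E A = r A.
Proof.
move=> rr AE; have := dualrK (dualr_rank rr E) E A; have := dualrE E rr.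
have := dualrK rr E (E :\: A).
rewrite setDDr setDv set0U (setIidPr AE) (setIidPl AE) (setIidPl (subsetDl _ _)).
have := cardsID A E; rewrite (setIidPr AE); lia.
Qed.

Lemma valid_dual P S r E : rank_fun r -> valid P S r E ->
  valid S P (dualr r E) E.
Proof.
move=> rr v e eE; have [v1 v2] := v e eE; split=> h.
  by apply: v2; have := dualr1 rr eE; lia.
apply: v1; have := dualrD1 rr eE; have := dualrE E rr; have := rk1 rr e.
by lia.
Qed.

Lemma ratio_ge_dual g P S r E : rank_fun r ->
  ratio_ge g S P (dualr r E) E -> ratio_ge g P S r E.
Proof. by move=> rr; rewrite /ratio_ge !tw_dual // mulrC [X in _ <= X]mulrC mulrC. Qed.

(** Without an element that is neither a loop nor a coloop, a valid doubled matroid is a direct sum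
    of 2-circuits if every element is doubled, and its ratio is exactly 1. *)
Definition nonfree r E : bool :=
  [exists e in E, (0 < r [set e])%N && (r (E :\ e) == r E)].

Lemma nonfree_dual r E : rank_fun r -> nonfree (dualr r E) E = nonfree r E.
Proof.
move=> rr; apply: eq_existsb => e; case: (boolP (e \in E)) => //= eE.
have h1 := dualr1 rr eE; have h2 := dualrD1 rr eE; have h3 := dualrE E rr.
have h4 := rk1 rr e; have h5 := rk_setD1_le rr e E.
by apply/andP/andP => -[h6 /eqP h7]; split; try apply/eqP; lia.
Qed.

(* Since [r E <= #|E :&: S| + r (E :\: S)], the truncated subtraction is exact:
   the second summand is the dual rank of the series pairs. *)
Definition pair_rank P S r E : nat :=
  (r (E :&: P) + (#|E :&: S| + r (E :\: S) - r E))%N.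

Lemma pair_rank_dual P S r E : rank_fun r ->
  pair_rank S P (dualr r E) E = pair_rank P S r E.
Proof.
move=> rr; rewrite /pair_rank.
have h1 := dualrK rr E (E :&: S); have h2 := dualrK rr E (E :\: P).
have h3 := dualrE E rr; have h4 := rk_setD rr E S; have h5 := cardsID P E.
move: h1 h2; rewrite (setIidPl (subsetIl _ _)) (setIidPl (subsetDl _ _)).
rewrite setDDr setDv set0U setDIr setDv set0U; lia.
Qed.

Lemma pair_rank_del P S r E e : rank_fun r -> [disjoint P & S] -> e \in P ->
  (pair_rank P S r (E :\ e) <= pair_rank P S r E)%N.
Proof.
move=> rr PS eP; rewrite /pair_rank.
have h1 : r ((E :\ e) :&: P) = r ((E :&: P) :\ e) by rewrite setIDAC.
have h2 : (E :\ e) :&: S = E :&: S.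
  rewrite setIDAC; apply/setDidPl; rewrite disjoint_sym disjoints1 inE.
  by rewrite (notS PS eP) andbF.
have h3 : (E :\ e) :\: S = (E :\: S) :\ e by rewrite !setDDl setUC.
have h4 := rk_setD1_le rr e (E :&: P).
have [eE|eE] := boolP (e \in E); last first.
  suff -> : E :\ e = E by []; apply/setDidPl.
  by rewrite disjoint_sym disjoints1.
have := rk_dim rr e (setSD [set e] (subsetDl E S)).
rewrite !setD1K ?inE ?eE ?(notS PS eP) // h1 h2 h3.
have := rk_setD rr E S; lia.
Qed.

Lemma pair_rank_coloop P S r E e : rank_fun r -> [disjoint P & S] -> e \in P ->
  e \in E -> (r (E :\ e) < r E)%N -> (pair_rank P S r (E :\ e) < pair_rank P S r E)%N.
Proof.
move=> rr PS eP eE cle; rewrite /pair_rank.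
have h2 : (E :\ e) :&: S = E :&: S.
  rewrite setIDAC; apply/setDidPl; rewrite disjoint_sym disjoints1 inE.
  by rewrite (notS PS eP) andbF.
have h3 : (E :\ e) :\: S = (E :\: S) :\ e by rewrite !setDDl setUC.
have h4 := rk_dim rr e (setSD [set e] (subsetIl E P)).
have h5 := rk_dim rr e (setSD [set e] (subsetDl E S)).
move: h4 h5; rewrite !setD1K ?inE ?eE ?eP ?(notS PS eP) // h2 h3 setIDAC.
have := rk_setD rr E S; lia.
Qed.

Lemma pair_rank_ctr P S r E e : rank_fun r -> [disjoint P & S] -> e \in P ->
  e \in E -> r [set e] = 1%N ->
  ((pair_rank P S (ctr r e) (E :\ e)).+1 = pair_rank P S r E)%N.
Proof.
move=> rr PS eP eE e1; rewrite /pair_rank.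
have h2 : (E :\ e) :&: S = E :&: S.
  rewrite setIDAC; apply/setDidPl; rewrite disjoint_sym disjoints1 inE.
  by rewrite (notS PS eP) andbF.
have h3 : (E :\ e) :\: S = (E :\: S) :\ e by rewrite !setDDl setUC.
have := ctrK rr e ((E :\ e) :&: P); have := ctrK rr e ((E :\ e) :\: S).
have := ctrK rr e (E :\ e).
rewrite setIDAC h3 !setD1K ?inE ?eE ?eP ?(notS PS eP) // h2 e1.
have := rk_setD rr E S; lia.
Qed.

End Duality.

(* Each step down in [k] below 5 gains a factor 6/5, the loss of
   [ratio_ge_par_step]; 36/25 is the ratio of a triangle with one edge doubled,
   7/4 that of four parallel elements. *)
Definition ratio_lb (k n : nat) (nf : bool) : rat :=
  if ~~ nf then 1 else
  if (k <= 1)%N then (if (n <= 2)%N then 7%:R / 4%:R else 21%:R / 10%:R) else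
  if (k <= 2)%N && (3 <= n)%N then 7%:R / 4%:R else
  if (k <= 3)%N then 36%:R / 25%:R else
  if (k <= 4)%N then 6%:R / 5%:R else 1.

(** * Arithmetic of the lower bounds *)

Ltac ratio_lb_tac := rewrite /ratio_lb;
  repeat match goal with |- context [if ?b then _ else _] =>
    let h := fresh in case h : b end;
  first [ exfalso; lia | lra ].

Lemma ratio_lb_ge1 k n nf : 1 <= ratio_lb k n nf.
Proof. ratio_lb_tac. Qed.

Lemma ratio_lb_big k n nf : (2 <= k)%N -> ratio_lb k n nf <= 7%:R / 4%:R.
Proof. by move=> k2; ratio_lb_tac. Qed.

Lemma ratio_lb_drop k n (nf : bool) k' n' (nf' : bool) :
  (2 <= k)%N -> (k' < k)%N -> (n <= n'.+1)%N ->
  (nf -> nf') -> ratio_lb k n nf <= ratio_lb k' n' nf'.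
Proof.
move=> k2 lt_k le_n; case: nf => [/(_ isT) ->|_]; last exact: ratio_lb_ge1.
ratio_lb_tac.
Qed.

(** The excluded case k = 2, n = 3 is real: deleting an element may bring the guarantee down from
    7/4 to 36/25. *)
Lemma ratio_lb_del k n (nf : bool) k' n' (nf' : bool) :
  (2 <= k)%N -> (k' <= k)%N -> (n <= n'.+1)%N ->
  (k = 2 -> n <> 3)%N -> (nf -> nf') -> ratio_lb k n nf <= ratio_lb k' n' nf'.
Proof.
move=> k2 lt_k le_n k3; case: nf => [/(_ isT) ->|_]; last exact: ratio_lb_ge1.
ratio_lb_tac.
Qed.

(** The gain 36/25 alone pays for every target with k + 1 >= 3 or n <= 2. The target 7/4 at k + 1 =
    2 needs the smaller matroid's own bound, hence the condition on [nf']. *)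
Lemma ratio_lb_triangle k n nf n' (nf' : bool) : (1 <= k)%N -> (n <= n'.+1)%N ->
  ((k <= 1)%N -> (2 <= n')%N -> nf') ->
  ratio_lb k.+1 n nf <= 36%:R / 25%:R * ratio_lb k n' nf'.
Proof.
move=> k1 le_n; case: nf' => [_|h]; first by ratio_lb_tac.
have {}h : ~ ((k <= 1)%N /\ (2 <= n')%N) by move=> [a b]; have := h a b.
by ratio_lb_tac.
Qed.

(** The budget of contractions: 6/5 * 7/4 = 21/10, 6/5 * 36/25 = 216/125 < 7/4, and exact powers of
    6/5 above. The bound n >= 4 leaves n' >= 3 elements, from where the values 21/10 and 7/4
    hold. *)
Lemma ratio_lb_ctr k n n' : (1 <= k <= 4)%N -> (4 <= n)%N -> (n <= n'.+1)%N ->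
  6%:R / 5%:R * ratio_lb k.+1 n true <= ratio_lb k n' true.
Proof. by move=> /andP[k1 k4] n4 le_n; ratio_lb_tac. Qed.

(** * Every element doubled: base cases, coloops and repeated parallel pairs *)

Section ThickMatroids.

Variable T : finType.
Implicit Types (A B E F P S : {set T}) (e f : T) (r : {set T} -> nat).

Lemma setD1_swap E e f : e \in E -> e != f -> e |: (E :\ e :\ f) = E :\ f.
Proof.
move=> eE ef; apply/setP=> x; rewrite !inE.
by case: (x =P e) => [->|] //=; rewrite eE ef.
Qed.

Lemma setD1C E e f : E :\ e :\ f = E :\ f :\ e.
Proof. by rewrite !setDDl setUC. Qed.

Lemma valid_coloop P S r E e : rank_fun r -> e \in E -> (r (E :\ e) < r E)%N ->
  valid P S r E -> valid P S r (E :\ e).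
Proof.
move=> rr eE cle v h; rewrite inE => /andP[_ hE]; have [v1 v2] := v h hE.
split=> // clh; apply: v2; have := rk_setD1 rr e (E :\ h).
by rewrite setD1C; lia.
Qed.

Lemma par_setD1 r E e f h : rank_fun r -> e \in E -> f \in E -> e != h ->
  f != h -> e != f -> r [set e] = 1%N -> r [set e; f] = 1%N ->
  r (E :\ f :\ h) = r (E :\ h).
Proof.
move=> rr eE fE eh fh ef e1 ef1; rewrite -(setD1_swap fE fh); symmetry.
apply: (rk_cl rr (A := [set e])); last by rewrite setUC ef1.
by rewrite sub1set !inE eh ef.
Qed.

Lemma valid_par P S r E e f : rank_fun r -> e \in E -> f \in E -> e != f ->
  e \in P -> r [set e] = 1%N -> r [set e; f] = 1%N ->
  valid P S r E -> valid P S r (E :\ f).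
Proof.
move=> rr eE fE ef eP e1 ef1 v h; rewrite !inE => /andP[hf hE].
have [v1 v2] := v h hE; split=> // clh.
have [<-//|eh] := eqVneq e h; apply: v2.
rewrite -(par_setD1 rr eE fE eh _ ef) 1?eq_sym //.
by have := rk_setD1_le rr f E; lia.
Qed.

Lemma valid_ctr P S r E e : rank_fun r -> e \in E -> r [set e] = 1%N ->
  (forall f, f \in E -> f != e -> r [set e; f] = 1%N -> f \in S) ->
  valid P S r E -> valid P S (ctr r e) (E :\ e).
Proof.
move=> rr eE e1 par v h; rewrite !inE => /andP[he hE].
have [v1 v2] := v h hE; split=> hh.
  by apply: par => //; have := ctrK rr e [set h]; lia.
apply: v2; have := ctrK rr e (E :\ e); have := ctrK rr e (E :\ e :\ h).
by rewrite setD1K // setD1_swap 1?eq_sym //; lia.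
Qed.

Record thick P S r E : Prop := Thick {
  tk_rank : rank_fun r;
  tk_disj : [disjoint P & S];
  tk_valid : valid P S r E;
  tk_sub : E \subset P :|: S
}.

Lemma thick_dual P S r E : thick P S r E -> thick S P (dualr r E) E.
Proof.
case=> rr PS v sub; split.
- exact: dualr_rank.
- by rewrite disjoint_sym.
- exact: valid_dual.
- by rewrite setUC.
Qed.

Lemma thick_PS P S r E e : thick P S r E -> e \in E -> e \notin P -> e \in S.
Proof.
by move=> tk eE eP; have := subsetP (tk_sub tk) e eE; rewrite inE (negPf eP).
Qed.

Definition ratio_ok P S r E : Prop := (pair_rank P S r E <= 5)%N ->
  ratio_ge (ratio_lb (pair_rank P S r E) #|E| (nonfree r E)) P S r E.

Lemma ratio_ok_dual P S r E : rank_fun r ->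
  ratio_ok S P (dualr r E) E -> ratio_ok P S r E.
Proof.
by move=> rr; rewrite /ratio_ok pair_rank_dual // nonfree_dual // => h k5;
   apply: ratio_ge_dual => //; apply: h.
Qed.

Definition ratio_ih E : Prop := forall P S r F,
  thick P S r F -> (#|F| < #|E|)%N -> ratio_ok P S r F.

Definition clean r E : Prop :=
  forall e, e \in E -> r [set e] = 1%N /\ r (E :\ e) = r E.

Lemma clean_dual r E : rank_fun r -> clean r E -> clean (dualr r E) E.
Proof.
move=> rr cl e eE; have [e1 nce] := cl e eE.
have h1 := dualr1 rr eE; have h2 := dualrD1 rr eE; have h3 := dualrE E rr.
by split; lia.
Qed.

Lemma nonfreeP r E : reflect
  (exists e, [/\ e \in E, (0 < r [set e])%N & r (E :\ e) = r E]) (nonfree r E).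
Proof.
apply: (iffP exists_inP) => [[e eE /andP[h1 /eqP h2]]|[e [eE h1 h2]]].
  by exists e.
by exists e => //; rewrite h1 h2 eqxx.
Qed.

(** If the dual rank of [S] is 0, an element outside [P] would be a coloop, which validity allows
    only in [P]. *)
Lemma pair_rank_le1_series P S r E : thick P S r E ->
  (#|E :&: S| + r (E :\: S) - r E = 0)%N -> E \subset P.
Proof.
move=> tk s0; have rr := tk_rank tk; apply/subsetP=> e eE.
apply/negPn/negP=> eP; have eS := thick_PS tk eE eP.
suff /(tk_valid tk eE).2 : (r (E :\ e) < r E)%N by apply/negP.
have h1 := dualr1 rr eE; have h2 := dualrK rr E (E :&: S).
have : [set e] \subset E :&: S by rewrite sub1set inE eE.
move=> /(rk_mono (dualr_rank rr E)).
move: h2; rewrite (setIidPl (subsetIl _ _)) setDIr setDv set0U; lia.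
Qed.

(** This is 21/10 (2n)^2 <= 2 (4^n - 2), the bound for [n] parallel pairs in one class, cleared of
    denominators. It fails at n = 2. *)
Lemma pow4_ge n : (3 <= n)%N -> (42 * n ^ 2 + 20 <= 10 * 4 ^ n)%N.
Proof.
elim: n => // n IH; rewrite leq_eqVlt => /predU1P[<-//|n3].
by have := IH n3; rewrite (expnS 4); nia.
Qed.

Lemma pair_rank_le1_par P S r E : thick P S r E -> (pair_rank P S r E <= 1)%N ->
  E \subset P -> ratio_ok P S r E /\ ((2 <= #|E|)%N -> nonfree r E).
Proof.
move=> tk k1 EP; have rr := tk_rank tk; have PS := tk_disj tk.
have nl e : e \in E -> r [set e] = 1%N.
  move=> eE; have := rk1 rr e; case h : (r [set e]) => [|[]] // _.
  by have := (tk_valid tk eE).1 h; rewrite (notS PS) // (subsetP EP).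
have [E0|[e eE]] := set_0Vmem E.
  rewrite E0 cards0; split=> // _; rewrite /ratio_ge !tw0.
  by have -> : nonfree r set0 = false by apply/nonfreeP => -[e []]; rewrite inE.
have rE : r E = 1%N.
  have : (r E <= 1)%N by move: k1; rewrite /pair_rank (setIidPl EP); lia.
  have : [set e] \subset E by rewrite sub1set.
  by move=> /(rk_mono rr); rewrite nl //; lia.
have nf : nonfree r E = (2 <= #|E|)%N.
  apply/nonfreeP/idP => [[f [fE _ h]]|n2].
    have [F0|[g]] := set_0Vmem (E :\ f); first by move: h; rewrite F0 (rk0 rr) rE.
    by rewrite (cardsD1 f E) fE (cardsD1 g) => ->.
  exists e; rewrite nl //; split=> //.
  have /card_gt0P[f fE] : (0 < #|E :\ e|)%N by move: n2; rewrite (cardsD1 e) eE.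
  have : [set f] \subset E :\ e by rewrite sub1set.
  have fE' : f \in E by move: fE; rewrite inE => /andP[].
  by move=> /(rk_mono rr); have := rk_setD1_le rr e E; rewrite nl // rE; lia.
split; last by rewrite nf.
move=> _; have [h20 h02 h11] := tw_line PS rr EP rE nl.
rewrite /ratio_ge h20 h02 h11 nf /ratio_lb k1.
have n0 : (0 < #|E|)%N by apply/card_gt0P; exists e.
have [n1|[n2|n3]] : (#|E| = 1 \/ #|E| = 2 \/ 3 <= #|E|)%N by lia.
- by rewrite n1 /=; lra.
- by rewrite n2 /=; lra.
rewrite (_ : (2 <= #|E|)%N) /=; last by lia.
rewrite (_ : (#|E| <= 2)%N = false) /=; last by lia.
have := pow4_ge n3; rewrite -(ler_nat rat) natrD !natrM !natrX.
by rewrite exprMn; lra.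
Qed.

(** One of the two summands of the pair rank vanishes, so up to duality all elements lie in [P] and
    form a single parallel class. *)
Lemma pair_rank_le1 P S r E : thick P S r E -> (pair_rank P S r E <= 1)%N ->
  ratio_ok P S r E /\ ((2 <= #|E|)%N -> nonfree r E).
Proof.
move=> tk k1; have rr := tk_rank tk.
have [s0|s0] := eqVneq (#|E :&: S| + r (E :\: S) - r E)%N 0%N.
  by apply: pair_rank_le1_par => //; apply: pair_rank_le1_series tk _.
have tk' := thick_dual tk.
have EP : E \subset S.
  apply: pair_rank_le1_series tk' _.
  have := k1; rewrite -(pair_rank_dual P S E rr).
  move: (k1) s0; rewrite /pair_rank.
  have h2 := dualrK rr E (E :&: S).
  move: h2; rewrite (setIidPl (subsetIl _ _)) setDIr setDv set0U; lia.
have [] := pair_rank_le1_par tk' _ EP; first by rewrite pair_rank_dual.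
by rewrite nonfree_dual // => h1 h2; split=> //; apply: ratio_ok_dual.
Qed.

Lemma ratio_ok_coloop P S r E e : thick P S r E -> ratio_ih E -> e \in E ->
  (r (E :\ e) < r E)%N -> (2 <= pair_rank P S r E)%N -> ratio_ok P S r E.
Proof.
move=> tk ih eE cle k2 k5; have rr := tk_rank tk; have PS := tk_disj tk.
have eP := (tk_valid tk eE).2 cle.
have lt_k := pair_rank_coloop rr PS eP eE cle.
have tk' : thick P S r (E :\ e).
  split=> //; first exact: valid_coloop (tk_valid tk).
  by apply: subset_trans (tk_sub tk); apply: subsetDl.
have cE : #|E| = #|E :\ e|.+1 by rewrite (cardsD1 e E) eE.
have b := ih _ _ _ _ tk'; rewrite cE ltnS leqnn in b.
have k5' : (pair_rank P S r (E :\ e) <= 5)%N by lia.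
apply: (ratio_ge_coloop PS rr eE eP cle); apply: ratio_ge_le _ (b isT k5').
rewrite cE; apply: ratio_lb_drop => // /nonfreeP[f [fE f1 ncf]]; apply/nonfreeP; exists f.
  have fe : f != e by apply: contraTneq cle => <-; rewrite ncf ltnn.
  rewrite !inE fe fE f1; split=> //.
  have := rk_setD1 rr e (E :\ f); have := rk_setD1_le rr f (E :\ e).
  by rewrite setD1C; lia.
Qed.

Lemma pair_rank_sub P S r E : rank_fun r -> [disjoint P & S] -> E \subset P ->
  pair_rank P S r E = r E.
Proof.
move=> rr PS EP; rewrite /pair_rank (setIidPl EP).
have ES : [disjoint E & S] := disjointWl EP PS.
by rewrite (setDidPl ES) (disjoint_setI0 ES) cards0 add0n subnn addn0.
Qed.

Lemma pair_rank1 r E e f : rank_fun r -> r E = 1%N -> e \in E -> f \in E ->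
  r [set e] = 1%N -> r [set e; f] = 1%N.
Proof.
move=> rr rE eE fE e1; have := rk_mono rr (subsetUl [set e] [set f]).
have : [set e; f] \subset E by rewrite subUset !sub1set eE.
by move=> /(rk_mono rr); lia.
Qed.

Lemma ratio_ok_par P S r E e f : thick P S r E -> ratio_ih E -> clean r E ->
  e \in E -> f \in E -> e != f -> e \in P -> f \in P -> r [set e; f] = 1%N ->
  (2 <= pair_rank P S r E)%N -> ratio_ok P S r E.
Proof.
move=> tk ih cl eE fE ef eP fP ef1 k2 k5.
have rr := tk_rank tk; have PS := tk_disj tk.
have [e1 nce] := cl e eE; have [f1 ncf] := cl f fE.
have eEf : e \in E :\ f by rewrite !inE ef.
have cE : #|E| = #|E :\ f :\ e|.+2.
  by rewrite (cardsD1 f E) fE (cardsD1 e (E :\ f)) eEf.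
have tk' : thick P S r (E :\ f).
  split=> //; first exact: valid_par eE fE ef eP e1 ef1 (tk_valid tk).
  by apply: subset_trans (tk_sub tk); apply: subsetDl.
have [F0|[h hF]] := set_0Vmem (E :\ f :\ e).
  have EE : E = [set e; f] by rewrite -(setD1K fE) -(setD1K eEf) F0 setU0 setUC.
  have EP : E \subset P by rewrite EE subUset !sub1set eP.
  by move: k2; rewrite pair_rank_sub // EE ef1.
have [he [hf hE]] : h != e /\ h != f /\ h \in E.
  by move: hF; rewrite !inE => /and3P[].
have [h1 nch] := cl h hE.
have parh : r (E :\ f :\ h) = r (E :\ h).
  by apply: par_setD1 e1 ef1; rewrite // eq_sym.
have nf' : nonfree r (E :\ f).
  by apply/nonfreeP; exists h; rewrite !inE hf hE h1 parh nch ncf.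
(* Induction is too weak in one case: three elements with k = 2 need 7/4, while two elements only
   guarantee 36/25. That case is evaluated by hand. *)
have [sp|nsp] := boolP ((pair_rank P S r E == 2) && (#|E| == 3))%N; last first.
  apply: (ratio_ge_par_par PS rr ef eE fE eP fP e1 f1 ef1).
    exact: le_trans (ratio_lb_ge1 _ _ _).
  have lek := pair_rank_del E rr PS fP.
  have b := ih _ _ _ _ tk'; have cE' : #|E :\ f| = #|E :\ f :\ e|.+1.
    by rewrite (cardsD1 e (E :\ f)) eEf.
  have ltE : (#|E :\ f| < #|E|)%N by rewrite cE cE'.
  apply: ratio_ge_le _ (b ltE (leq_trans lek k5)).
  apply: ratio_lb_del => //; first by rewrite cE cE'.
  by move=> kE nE; rewrite kE nE in nsp.
case/andP: sp => /eqP kE /eqP nE.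
have Fh : E :\ f :\ e = [set h].
  apply/esym/eqP; rewrite eqEcard sub1set hF cards1.
  by move: nE; rewrite cE => -[->].
have Eh : E :\ h = [set e; f].
  apply/setP=> x; move/setP/(_ x): Fh; rewrite !inE.
  case: (x =P e) => [->|xe]; first by rewrite eE andbT (eq_sym e h) he.
  case: (x =P f) => [->|xf]; first by rewrite fE andbT (eq_sym f h) hf orbT.
  by move=> /= ->; case: (x == h).
have rE : r E = 1%N by rewrite -nch Eh.
have hS : h \in S.
  apply: (thick_PS tk hE); apply/negP=> hP.
  have EP : E \subset P.
    apply/subsetP=> x xE; have [->//|xh] := eqVneq x h.
    have : x \in E :\ h by rewrite !inE xh.
    by rewrite Eh !inE => /orP[] /eqP ->.
  by move: kE; rewrite pair_rank_sub // rE.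
have hEfe : h \in E :\ f :\ e by [].
have rEf : r (E :\ f) = 1%N by rewrite ncf.
have eh1 : r [set e; h] = 1%N by apply: pair_rank1 rE _ _ _.
have fh1 : r [set f; h] = 1%N by apply: pair_rank1 rE _ _ _.
(* With [e], [f] in [P] and [h] in [S], all parallel, the values are T(2,0) = 6, T(0,2) = 30 and
   T(1,1) = 9, of ratio 20/9 > 7/4. *)
have [t20 t02 _ t11 _] := tw_par_par PS rr ef eE fE eP fP e1 f1 ef1.
rewrite /ratio_ge t20 t02 t11.
have rFe : r (E :\ f :\ e) = r (E :\ f) by rewrite Fh h1.
have clh : (r (E :\ f :\ e :\ h) < r (E :\ f :\ e))%N.
  by rewrite Fh setDv (rk0 rr) h1.
rewrite !(tw_reg P S _ _ rr eEf e1 rFe) !(tw_coloop P S _ _ rr hEfe clh).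
have leh := par_ctr_loop e1 eh1; have lfh := par_ctr_loop f1 fh1.
rewrite !(tw_loop P S _ _ (ctr_rank rr e) hEfe leh).
rewrite !(tw_loop P S _ _ (ctr_rank rr f) hEfe lfh).
rewrite Fh setDv !tw0 (notS PS eP) eP hS (notP PS hS) !expr0 !expr1.
have := ratio_lb_big #|E| (nonfree r E) k2; lra.
Qed.

End ThickMatroids.

(** * Every element doubled: the induction *)

Section ThickInduction.

Variable T : finType.
Implicit Types (A B E F P S : {set T}) (e f : T) (r : {set T} -> nat).

Lemma card_del E e : e \in E -> #|E| = #|E :\ e|.+1.
Proof. by move=> eE; rewrite (cardsD1 e E) eE. Qed.

Lemma rk_coloops r E : rank_fun r ->
  (forall e, e \in E -> (r (E :\ e) < r E)%N) -> r E = #|E|.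
Proof.
move=> rr cl; suff h A : A \subset E -> r A = #|A| by apply: h.
elim/(@set_ind T): A => [|e A eA IH]; first by rewrite (rk0 rr) cards0.
rewrite subUset sub1set => /andP[eE AE]; rewrite cardsU1 eA -(IH AE).
have AEe : A \subset E :\ e by rewrite subsetD1 AE.
have := rk_dim rr e AEe; rewrite setD1K //.
by have := rk_add1 rr e A; have := cl e eE; lia.
Qed.

Lemma rk_loops r E : rank_fun r ->
  (forall e, e \in E -> r [set e] = 0%N) -> r E = 0%N.
Proof.
move=> rr lo; suff h A : A \subset E -> r A = 0%N by apply: h.
elim/(@set_ind T): A => [|e A eA IH]; first by rewrite (rk0 rr).
rewrite subUset sub1set => /andP[eE AE]; rewrite -(IH AE).
by apply: (rk_cl rr (sub0set A)); rewrite setU0 lo // (rk0 rr).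
Qed.

(** Contracting [e] lowers the pair rank by one and stays valid: the elements that become loops are
    parallel to [e], hence in [S]. *)
Lemma ratio_ok_triangle P S r E e f : thick P S r E -> ratio_ih E ->
  clean r E -> e \in E -> f \in E -> e \in P -> f \in S ->
  r [set e; f] = 1%N -> (r (E :\ e :\ f) < r (E :\ e))%N ->
  (forall g, g \in E -> g != e -> g \in P -> r [set e; g] <> 1%N) ->
  (2 <= pair_rank P S r E)%N -> ratio_ok P S r E.
Proof.
move=> tk ih cl eE fE eP fS ef1 clf npar k2 k5.
have rr := tk_rank tk; have PS := tk_disj tk.
have [e1 nce] := cl e eE; have [f1 _] := cl f fE.
have kE := pair_rank_ctr rr PS eP eE e1; have cE := card_del eE.
have tk' : thick P S (ctr r e) (E :\ e).
  split=> //; first exact: ctr_rank.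
  - apply: (valid_ctr rr eE e1 _ (tk_valid tk)) => g gE ge eg1.
    by apply: (thick_PS tk gE); apply/negP => /(npar g gE ge).
  - by apply: subset_trans (tk_sub tk); apply: subsetDl.
have ltE : (#|E :\ e| < #|E|)%N by rewrite cE.
have k1 : (1 <= pair_rank P S (ctr r e) (E :\ e))%N by rewrite -ltnS kE.
have k5' : (pair_rank P S (ctr r e) (E :\ e) <= 5)%N by apply: ltnW; rewrite kE.
have b := ih _ _ _ _ tk' ltE k5'.
apply: ratio_ge_le (ratio_ge_triangle PS rr eE fE eP fS e1 f1 ef1 nce clf b).
rewrite -kE; apply: ratio_lb_triangle => //; first by rewrite cE.
by move=> /(pair_rank_le1 tk')[_].
Qed.

(** With loops excluded, every element of [E :\ e] is a coloop there, so none lies in [S]. Hence [E]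
    is a circuit of 3 to 6 parallel pairs; the smallest ratio is 23/12, at three. *)
Lemma ratio_ge_circuit P S r E e : thick P S r E -> clean r E -> e \in E ->
  e \in P -> (forall f, f \in E :\ e -> f \in S ->
    ~ (r (E :\ e :\ f) < r (E :\ e))%N) ->
  nonfree r (E :\ e) = false -> (2 <= pair_rank P S r E <= 5)%N ->
  ratio_ge (7%:R / 4%:R) P S r E.
Proof.
move=> tk cl eE eP good nf k25; have rr := tk_rank tk; have PS := tk_disj tk.
have clF g : g \in E :\ e -> (r (E :\ e :\ g) < r (E :\ e))%N.
  move=> gF; have gE : g \in E by move: gF; rewrite inE => /andP[].
  rewrite ltn_neqAle rk_setD1_le // andbT; apply: contraFneq nf => h.
  by apply/nonfreeP; exists g; rewrite (cl g gE).1.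
have EP : E \subset P.
  apply/subsetP=> g gE; have [->//|ge] := eqVneq g e.
  have gF : g \in E :\ e by rewrite !inE ge.
  by apply/negPn/negP=> gP; apply: (good g gF (thick_PS tk gE gP)); apply: clF.
have rE : (r E).+1 = #|E|.
  by rewrite -(cl e eE).2 (rk_coloops rr clF) -card_del.
have [h20 h02 h11] := tw_circuit PS rr EP rE (fun x xE => (cl x xE).2).
rewrite pair_rank_sub // in k25; rewrite /ratio_ge h20 h02.
have -> : tw 1 1 P S r E = #|E|%:R * 2 ^+ #|E| / 2%:R by rewrite -h11; field.
rewrite -rE; have {k25} [->|[->|[->|->]]] :
    (r E = 2 \/ r E = 3 \/ r E = 4 \/ r E = 5)%N by move: k25; clear; lia.
all: clear; lra.
Qed.

(** One parallel pair together with [n] series pairs, all parallel to each other. Equality holds at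
    n = 2; n = 1 would give only 36/25. *)
Lemma cocircuit_num (n : nat) : (2 <= n <= 4)%N ->
  7%:R / 4%:R * (1 * (n%:R * 2 ^+ n / 2%:R) + (1 + 1) * (1 + 1) ^+ n) ^+ 2 <=
  (1 * (2 * 3 ^+ n - 2 ^+ n) + (1 + 0) * (0 + 2) ^+ n) *
  (1 * (2 ^+ n - 2) + (1 + 2) * (2 + 0) ^+ n) :> rat.
Proof.
move=> h; have {h} [->|[->|->]] : (n = 2 \/ n = 3 \/ n = 4)%N by lia.
all: lra.
Qed.

(** A coloop of the contraction would be a coloop of [E], so all elements left are loops, that is
    parallel to [e], and therefore in [S]. The deletion is dual to a circuit of parallel pairs,
    which gives its values. *)
Lemma ratio_ge_cocircuit P S r E e : thick P S r E -> clean r E -> e \in E ->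
  e \in P -> (forall f, f \in E :\ e -> f \in S ->
    ~ (r (E :\ e :\ f) < r (E :\ e))%N) ->
  (forall g, g \in E -> g != e -> g \in P -> r [set e; g] <> 1%N) ->
  nonfree (ctr r e) (E :\ e) = false -> (2 <= pair_rank P S r E <= 5)%N ->
  ratio_ge (7%:R / 4%:R) P S r E.
Proof.
move=> tk cl eE eP good npar nf k25.
have rr := tk_rank tk; have PS := tk_disj tk; have rre := ctr_rank rr e.
have [e1 nce] := cl e eE.
have parF g : g \in E :\ e -> ctr r e [set g] = 0%N.
  move=> gF; have /andP[ge gE] : (g != e) && (g \in E) by move: gF; rewrite !inE.
  apply/eqP; rewrite -leqn0 leqNgt; apply: contraFN nf => h.
  apply/nonfreeP; exists g; split=> //.
  have := ctrK rr e (E :\ e :\ g); have := ctrK rr e (E :\ e).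
  rewrite setD1K // setD1_swap 1?eq_sym // (cl g gE).2.
  by clear; lia.
have SF : E :\ e \subset S.
  apply/subsetP=> g gF.
  have /andP[ge gE] : (g != e) && (g \in E) by move: gF; rewrite !inE.
  apply: (thick_PS tk gE); apply/negP => /(npar g gE ge); apply.
  by have := ctrK rr e [set g]; rewrite parF // e1.
have rF0 : ctr r e (E :\ e) = 0%N := rk_loops rre parF.
have rE : r E = 1%N by have := ctrK rr e (E :\ e); rewrite setD1K // rF0 e1.
have rF : r (E :\ e) = 1%N by rewrite nce.
have SP : [disjoint S & P] by rewrite disjoint_sym.
have kE : pair_rank P S r E = #|E|.
  rewrite /pair_rank (card_del eE).
  have -> : E :&: P = [set e].
    apply/setP=> x; rewrite !inE; have [->|xe] := eqVneq x e; first by rewrite eE.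
    case: (boolP (x \in E)) => //= xE; apply: (notP PS); apply: (subsetP SF).
    by rewrite !inE xe.
  have -> : E :&: S = E :\ e.
    apply/setP=> x; rewrite !inE; have [->|xe] := eqVneq x e.
      by rewrite (notS PS eP) andbF.
    by case: (boolP (x \in E)) => //= xE; apply: (subsetP SF); rewrite !inE xe.
  have -> : E :\: S = [set e].
    apply/setP=> x; rewrite !inE; have [->|xe] := eqVneq x e.
      by rewrite (notS PS eP).
    by case: (boolP (x \in E)) => xE; rewrite ?andbF //=;
       rewrite (subsetP SF) // !inE xe.
  by rewrite e1 rE addnK.
have rrF := dualr_rank rr (E :\ e); have rrC := dualr_rank rre (E :\ e).
have rdF : (dualr r (E :\ e) (E :\ e)).+1 = #|E :\ e|.
  by have := dualrE (E :\ e) rr; rewrite rF addn1.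
have ncF x : x \in E :\ e ->
    dualr r (E :\ e) (E :\ e :\ x) = dualr r (E :\ e) (E :\ e).
  move=> xF; have xE : x \in E by move: xF; rewrite inE => /andP[].
  by have := dualrD1 rr xF; rewrite rF (cl x xE).1 -rdF; clear; lia.
have [h20 h02 h11] := tw_circuit SP rrF SF rdF ncF.
have rdC : dualr (ctr r e) (E :\ e) (E :\ e) = #|E :\ e|.
  by have := dualrE (E :\ e) rre; rewrite rF0 addn0.
have hC X Y : tw X Y P S (ctr r e) (E :\ e) = (Y + X) ^+ #|E :\ e|.
  by rewrite -(tw_dual _ _ _ _ _ rre) (tw_free SP _ _ rrC SF rdC).
rewrite !(tw_dual _ _ _ _ _ rr) in h20 h02 h11.
have h11' : tw 1 1 P S r (E :\ e) = #|E :\ e|%:R * 2 ^+ #|E :\ e| / 2%:R.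
  by rewrite -h11; field.
(* A single series pair would be a coloop after deleting [e], contrary to [good]; the pair rank
   bounds the number from above. *)
have n1 : #|E :\ e| <> 1%N.
  move=> n1; have /card_gt0P[g gF] : (0 < #|E :\ e|)%N by rewrite n1.
  apply: (good g gF (subsetP SF _ gF)).
  have -> : E :\ e :\ g = set0.
    by apply/eqP; rewrite -cards_eq0; move: n1; rewrite (card_del gF) => -[->].
  by rewrite (rk0 rr) rF.
rewrite kE in k25; have cE := card_del eE; rewrite cE in k25.
have n24 : (2 <= #|E :\ e| <= 4)%N by move: k25 n1; clear; lia.
rewrite /ratio_ge !(tw_reg P S _ _ rr eE e1 nce) (notS PS eP) eP !expr0 !expr1.
rewrite h20 h02 h11' !hC.
exact: cocircuit_num n24.
Qed.

(** The conditions on [e] keep both minors valid: deletion creates no coloop in [S] and contraction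
    no loop in [P]. A minor with only loops and coloops has just the bound 1, too weak for the
    contraction step, so these two cases are settled explicitly. *)
Lemma ratio_ok_good P S r E e : thick P S r E -> ratio_ih E -> clean r E ->
  e \in E -> e \in P -> (forall f, f \in E :\ e -> f \in S ->
    ~ (r (E :\ e :\ f) < r (E :\ e))%N) ->
  (forall g, g \in E -> g != e -> g \in P -> r [set e; g] <> 1%N) ->
  (2 <= pair_rank P S r E)%N -> ratio_ok P S r E.
Proof.
move=> tk ih cl eE eP good npar k2 k5.
have rr := tk_rank tk; have PS := tk_disj tk; have rre := ctr_rank rr e.
have [e1 nce] := cl e eE.
have k25 : (2 <= pair_rank P S r E <= 5)%N by rewrite k2.
have le74 := ratio_lb_big #|E| (nonfree r E) k2.
case nfD : (nonfree r (E :\ e)); last first.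
  exact: ratio_ge_le le74 (ratio_ge_circuit tk cl eE eP good nfD k25).
case nfC : (nonfree (ctr r e) (E :\ e)); last first.
  exact: ratio_ge_le le74 (ratio_ge_cocircuit tk cl eE eP good npar nfC k25).
have cE := card_del eE; have ltE : (#|E :\ e| < #|E|)%N by rewrite cE.
have sub : E :\ e \subset P :|: S.
  by apply: subset_trans (tk_sub tk); apply: subsetDl.
have tkD : thick P S r (E :\ e).
  split=> // g gF; have gE : g \in E by move: gF; rewrite inE => /andP[].
  split; first by apply: (tk_valid tk gE).1.
  move=> clg; apply/negPn/negP=> gP.
  by apply: (good g gF (thick_PS tk gE gP)).
have tkC : thick P S (ctr r e) (E :\ e).
  split=> //; apply: (valid_ctr rr eE e1 _ (tk_valid tk)) => g gE ge eg1.
  by apply: (thick_PS tk gE); apply/negP => /(npar g gE ge).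
have kC := pair_rank_ctr rr PS eP eE e1; have kD := pair_rank_del E rr PS eP.
(* With at most three elements, a non-coloop of [E :\ e] forces rank at most 1; then the contraction
   has rank 0 and contains no non-loop. *)
have n4 : (4 <= #|E|)%N.
  rewrite ltnNge; apply/negP=> n3.
  case/nonfreeP: nfD => g [gF _ ncg].
  have rE : (r E <= 1)%N.
    rewrite -nce -ncg; apply: leq_trans (rk_card rr _) _.
    by move: n3; rewrite cE (card_del gF).
  case/nonfreeP: nfC => h [hF h0 _].
  have := rk_mono rre (_ : [set h] \subset E :\ e); rewrite sub1set => /(_ hF).
  have := ctrK rr e (E :\ e); rewrite setD1K // e1.
  by clear -h0 rE; lia.
have nfE : nonfree r E by apply/nonfreeP; exists e; rewrite e1.
have bD := ih _ _ _ _ tkD ltE (leq_trans kD k5).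
have k5' : (pair_rank P S (ctr r e) (E :\ e) <= 5)%N by apply: ltnW; rewrite kC.
have bC := ih _ _ _ _ tkC ltE k5'.
apply: (ratio_ge_par_step PS rr eE eP e1 nce).
- exact: le_trans (ratio_lb_ge1 _ _ _).
- apply: ratio_ge_le bD; apply: ratio_lb_del => //; first by rewrite cE.
  by move=> _ n3; rewrite n3 in n4.
- apply: ratio_ge_le bC; rewrite nfE nfC -kC.
  apply: ratio_lb_ctr => //; last by rewrite cE.
  by rewrite -ltnS kC k2 -ltnS kC.
Qed.

Theorem thick_ratio P S r E : thick P S r E -> ratio_ok P S r E.
Proof.
have [n] := ubnP #|E|; elim: n => // n IH in P S r E *; move=> ltn tk.
have ih : ratio_ih E.
  by move=> P' S' r' F tk' ltF; apply: IH => //; apply: leq_trans ltF _.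
have rr := tk_rank tk; have PS := tk_disj tk.
have tkd := thick_dual tk; have dd := ratio_ok_dual rr.
have [k1|k2] := leqP (pair_rank P S r E) 1; first by have [] := pair_rank_le1 tk k1.
have k2d : (2 <= pair_rank S P (dualr r E) E)%N by rewrite pair_rank_dual.
have [/exists_inP[e eE cle]|] := boolP [exists e in E, (r (E :\ e) < r E)%N].
  exact: (ratio_ok_coloop tk ih eE cle k2).
rewrite negb_exists_in => /forall_inP ncl.
have [/exists_inP[e eE /eqP loe]|] := boolP [exists e in E, r [set e] == 0%N].
  apply: dd; apply: (ratio_ok_coloop tkd ih eE _ k2d).
  have := dualrD1 rr eE; have := dualrE E rr; rewrite loe; clear; lia.
rewrite negb_exists_in => /forall_inP nlo.
have cl : clean r E.
  move=> e eE; have := ncl e eE; have := nlo e eE; have := rk1 rr e.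
  by have := rk_setD1_le rr e E; clear; lia.
have cld := clean_dual rr cl.
have [/exists_inP[e /setIP[eE eP] /exists_inP[f /setIP[fE fP] /andP[ef /eqP ef1]]]|] :=
  boolP [exists e in E :&: P, exists f in E :&: P, (e != f) && (r [set e; f] == 1%N)].
  exact: (ratio_ok_par tk ih cl eE fE ef eP fP ef1 k2).
move=> npp.
have {}npp e f : e \in E -> e \in P -> f \in E -> f != e -> f \in P ->
    r [set e; f] <> 1%N.
  move=> eE eP fE fe fP ef1; case/negP: npp; apply/exists_inP; exists e.
    by rewrite inE eE.
  by apply/exists_inP; exists f; rewrite ?inE ?fE // eq_sym fe ef1.
have [/exists_inP[e /setIP[eE eP] /exists_inP[f /setIP[fE fP] /andP[ef /eqP ef1]]]|] :=
  boolP [exists e in E :&: S, exists f in E :&: S,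
    (e != f) && (dualr r E [set e; f] == 1%N)].
  by apply: dd; apply: (ratio_ok_par tkd ih cld eE fE ef eP fP ef1 k2d).
move=> nss.
have {}nss e f : e \in E -> e \in S -> f \in E -> f != e -> f \in S ->
    dualr r E [set e; f] <> 1%N.
  move=> eE eP fE fe fP ef1; case/negP: nss; apply/exists_inP; exists e.
    by rewrite inE eE.
  by apply/exists_inP; exists f; rewrite ?inE ?fE // eq_sym fe ef1.
have [/exists_inP[e /setIP[eE eP] /exists_inP[f /setIP[fE fS] /andP[/eqP ef1 ser]]]|] :=
  boolP [exists e in E :&: P, exists f in E :&: S,
    (r [set e; f] == 1%N) && (r (E :\ e :\ f) < r (E :\ e))%N].
  by apply: (ratio_ok_triangle tk ih cl eE fE eP fS ef1 ser _ k2) => g *; apply: npp.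
move=> ntri.
have stepP e : e \in E -> e \in P -> ratio_ok P S r E \/
    exists f, [/\ f \in E, f \in S & (r (E :\ e :\ f) < r (E :\ e))%N].
  move=> eE eP; have [/exists_inP[f /setIP[fE fS] ser]|ns] :=
    boolP [exists f in E :&: S, (r (E :\ e :\ f) < r (E :\ e))%N].
    by right; exists f.
  left; apply: (ratio_ok_good tk ih cl eE eP _ _ k2) => [f fE fS ser|g *].
    case/negP: ns; apply/exists_inP; exists f => //.
    by move: fE; rewrite !inE fS => /andP[_ ->].
  exact: npp.
(* The dual obstruction read in the original matroid: [f] becomes a coloop of the dual without [e]
   only if it is parallel to [e]. *)
have pairD e f : e \in E -> f \in E -> f != e ->
    (dualr r E (E :\ e :\ f) < dualr r E (E :\ e))%N -> r [set e; f] = 1%N.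
  move=> eE fE fe; have ef : e != f by rewrite eq_sym.
  have h1 := dualr2 (dualr_rank rr E) ef eE fE.
  have h2 := dualrE E rr; have h3 := dualrE E (dualr_rank rr E).
  have h4 := (cld e eE).2; have h5 := rk_mono rr (subsetUl [set e] [set f]).
  rewrite (dualrr rr) in h1; last by rewrite subUset !sub1set eE.
  rewrite (dualrr rr) // in h3; have h6 := (cl e eE).1.
  by move: h1 h2 h3 h4 h5 h6; clear; lia.
have stepS f : f \in E -> f \in S -> ratio_ok P S r E \/
    exists g, [/\ g \in E, g \in P & r [set f; g] = 1%N].
  move=> fE fS; have [/exists_inP[g /setIP[gE gP] ser]|ns] :=
    boolP [exists g in E :&: P,
      (dualr r E (E :\ f :\ g) < dualr r E (E :\ f))%N].
    right; exists g; split=> //; apply: pairD => //.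
    by apply: contraTneq gP => ->; rewrite (notP PS fS).
  left; apply: dd.
  apply: (ratio_ok_good tkd ih cld fE fS _ _ k2d) => [g gE gP ser|g *].
    case/negP: ns; apply/exists_inP; exists g => //.
    by move: gE; rewrite !inE gP => /andP[_ ->].
  exact: nss.
(* If no element is good, [e] in [P] has some [f] in [S] that is a coloop without [e], and [f] is
   parallel to some [g] in [P]. Here g = e is the triangle already treated, and otherwise [g]
   remains in [E :\ e] and spans [f], which is then no coloop. *)
have main e : e \in E -> e \in P -> ratio_ok P S r E.
  move=> eE eP; have [//|[f [fE fS ser]]] := stepP e eE eP.
  have [//|[g [gE gP fg1]]] := stepS f fE fS.
  have fe : f != e by apply: contraTneq fS => ->; rewrite (notS PS eP).
  have fg : f != g by apply: contraTneq fS => ->; rewrite (notS PS gP).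
  have [ge|ge] := eqVneq g e.
    exfalso; case/negP: ntri; apply/exists_inP; exists e; first by rewrite inE eE.
    apply/exists_inP; exists f; first by rewrite inE fE.
    by rewrite ser andbT -ge setUC fg1.
  exfalso; move: ser; rewrite ltnNge => /negP; apply.
  have fEe : f \in E :\ e by rewrite !inE fe.
  rewrite -{1}(setD1K fEe) (rk_cl rr (A := [set g])) //.
    by rewrite sub1set !inE ge gE eq_sym fg.
  by rewrite fg1 (cl g gE).1.
have [E0|[x xE]] := set_0Vmem E.
  by move: k2; rewrite /pair_rank E0 !set0I set0D (rk0 rr) cards0.
have [xP|xP] := boolP (x \in P); first exact: main xE xP.
have xS := thick_PS tk xE xP.
by have [//|[g [gE gP _]]] := stepS x xE xS; apply: main gE gP.
Qed.

End ThickInduction.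

(** * Chains of cyclic flats under minors, merging and duality *)

Section Chains.

Variable T : finType.
Implicit Types (A B E F G P Q S : {set T}) (e f : T) (r : {set T} -> nat).

(* The cyclic flats of the doubled matroid, each recorded by its trace on [E]:
   an element of a series pair is never in the closure of a set that avoids the
   pair, and an element of a parallel pair is never a coloop of a set that
   contains the pair. *)
Definition cycflat P S r E F : Prop :=
  [/\ F \subset E,
      forall e, e \in E -> e \notin F -> e \notin S -> (r F < r (e |: F))%N
    & forall e, e \in F -> e \notin P -> r (F :\ e) = r F].

(** Chains are strictly increasing sequences here, because these can be mapped, reversed and
    concatenated. *)
Definition chain_le n P S r E : Prop := forall s : seq {set T},
  sorted (fun A B => A \proper B) s ->
  (forall F, F \in s -> cycflat P S r E F) -> (size s <= n)%N.

Lemma chain_le_map n P S r E P' S' r' E' (phi : {set T} -> {set T}) :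
  (forall F, cycflat P' S' r' E' F -> cycflat P S r E (phi F)) ->
  (forall F G, cycflat P' S' r' E' F -> cycflat P' S' r' E' G ->
    F \proper G -> phi F \proper phi G) ->
  chain_le n P S r E -> chain_le n P' S' r' E'.
Proof.
move=> h1 h2 h s ss sc; rewrite -(size_map phi s); apply: h.
  apply: (@homo_sorted_in _ _ (mem s)) ss; last exact/allP.
  by move=> F G Fs Gs; apply: h2; apply: sc.
by move=> F /mapP[G Gs ->]; apply/h1/sc.
Qed.

(** Closure in the direction of [e] only. It lifts cyclic flats of a minor on [E :\ e] to [E] and
    keeps inclusions strict. *)
Definition closeU r e F : {set T} := if r (e |: F) == r F then e |: F else F.

Lemma closeU_proper r e F G : rank_fun r -> e \notin G -> F \proper G ->
  closeU r e F \proper closeU r e G.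
Proof.
move=> rr eG /[dup] /proper_sub FG /properP[_ [x xG xF]].
have nxe : x != e by apply: contraNneq eG => <-.
apply/properP; split.
  rewrite /closeU; case: eqP => h.
    by rewrite (rk_cl rr FG h) eqxx setUS.
  by case: ifP => // _; apply: subset_trans FG (subsetUr _ _).
exists x; rewrite /closeU; first by case: ifP; rewrite ?inE xG ?orbT.
by case: ifP; rewrite ?inE (negPf xF) ?(negPf nxe).
Qed.

Lemma chain_del n P S r E e : rank_fun r -> e \in E ->
  chain_le n P S r E -> chain_le n P S r (E :\ e).
Proof.
move=> rr eE; apply: (chain_le_map (phi := closeU r e)) => [F|F G _ [GE _ _]];
  last first.
  by apply: closeU_proper => //; move: GE; rewrite subsetD1 => /andP[].
case; rewrite subsetD1 => /andP[FE eF] fl cy; rewrite /closeU.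
have [h|/eqP h] := eqVneq (r (e |: F)) (r F); split.
- by rewrite subUset sub1set eE.
- move=> x xE; rewrite !inE negb_or => /andP[xe xF] xS.
  have := fl x; rewrite !inE xe => /(_ xE xF xS).
  by have := rk_mono rr (setUS [set x] (subsetUr [set e] F)); lia.
- move=> x; rewrite !inE => /orP[/eqP->|xF] xP; first by rewrite setU1K.
  have xe : x != e by apply: contraNneq eF => <-.
  have := rk_setD1_le rr x (e |: F).
  have : F :\ x \subset (e |: F) :\ x by rewrite setSD // subsetUr.
  by move=> /(rk_mono rr); have := cy x xF xP; lia.
- exact: FE.
- move=> x xE xF xS; have [->|xe] := eqVneq x e.
    by have := rk_addge rr e F; lia.
  by apply: fl => //; rewrite !inE xe.
- exact: cy.
Qed.

Lemma chain_ctr n P S r E e : rank_fun r -> e \in E ->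
  chain_le n P S r E -> chain_le n P S (ctr r e) (E :\ e).
Proof.
move=> rr eE; apply: (chain_le_map (phi := closeU r e)) => [F|F G _ [GE _ _]];
  last first.
  by apply: closeU_proper => //; move: GE; rewrite subsetD1 => /andP[].
case; rewrite subsetD1 => /andP[FE eF] fl cy; rewrite /closeU.
have cF := ctrK rr e F.
have [h|/eqP h] := eqVneq (r (e |: F)) (r F); split.
- by rewrite subUset sub1set eE.
- move=> x xE; rewrite !inE negb_or => /andP[xe xF] xS.
  have := fl x; rewrite !inE xe => /(_ xE xF xS).
  by have := ctrK rr e (x |: F); rewrite setUCA; lia.
- move=> x; rewrite !inE => /orP[/eqP->|xF] xP; first by rewrite setU1K.
  have xe : x != e by apply: contraNneq eF => <-.
  have -> : (e |: F) :\ x = e |: (F :\ x).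
    by apply/setP=> y; rewrite !inE; case: (y =P e) => [->|] //=;
       rewrite eq_sym xe.
  by have := ctrK rr e (F :\ x); have := cy x xF xP; lia.
- exact: FE.
- move=> x xE xF xS; have [->|xe] := eqVneq x e.
    by have := rk_addge rr e F; lia.
  have := fl x; rewrite !inE xe => /(_ xE xF xS).
  have := ctrK rr e (x |: F); have := rk_dim rr e (subsetUr [set x] F); lia.
move=> x xF xP; have := ctrK rr e (F :\ x); have := cy x xF xP.
have := rk_add1 rr e (F :\ x); have := rk_addge rr e F.
have := rk_setD1_le rr x F; lia.
Qed.

(** If a cyclic flat contains [e], its lift also contains [f], and the two parallel elements keep
    each other from being coloops, as is required when they are not doubled. *)
Lemma chain_merge n P S r E e f : rank_fun r -> e != f -> e \in E -> f \in E ->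
  r [set e] = 1%N -> r [set f] = 1%N -> r [set e; f] = 1%N ->
  chain_le n P S r E -> chain_le n (e |: P) S r (E :\ f).
Proof.
move=> rr ef eE fE e1 f1 ef1.
apply: (chain_le_map (phi := closeU r f)) => [F|F G _ [GE _ _]]; last first.
  by apply: closeU_proper => //; move: GE; rewrite subsetD1 => /andP[].
case; rewrite subsetD1 => /andP[FE fF] fl cy; rewrite /closeU.
have eclf A : f \in A -> r (e |: A) = r A.
  move=> fA; apply: (rk_cl rr (A := [set f])); last by rewrite ef1.
  by rewrite sub1set.
have fcle A : e \in A -> r (f |: A) = r A.
  move=> eA; apply: (rk_cl rr (A := [set e])); last by rewrite setUC ef1.
  by rewrite sub1set.
have [h|/eqP h] := eqVneq (r (f |: F)) (r F); split.
- by rewrite subUset sub1set fE.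
- move=> x xE; rewrite !inE negb_or => /andP[xf xF] xS.
  have := fl x; rewrite !inE xf => /(_ xE xF xS).
  by have := rk_mono rr (setUS [set x] (subsetUr [set f] F)); lia.
- move=> x; rewrite !inE => /orP[/eqP->|xF] xP; first by rewrite setU1K.
  have [xe|xe] := eqVneq x e.
    rewrite -{2}(setD1K (_ : x \in f |: F)); last by rewrite !inE xF orbT.
    by rewrite xe eclf // !inE eq_sym ef eqxx.
  have := rk_setD1_le rr x (f |: F).
  have : F :\ x \subset (f |: F) :\ x by rewrite setSD // subsetUr.
  move=> /(rk_mono rr); have := cy x xF; rewrite !inE (negPf xe) => /(_ xP); lia.
- exact: FE.
- move=> x xE xF xS; have [->|xf] := eqVneq x f.
    by have := rk_addge rr f F; lia.
  by apply: fl => //; rewrite !inE xf.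
move=> x xF xP; apply: cy => //; rewrite !inE negb_or xP andbT.
by apply: contra_notN h => /eqP xe; apply: fcle; rewrite -xe.
Qed.

Lemma cycflat_dual P S r E F : rank_fun r ->
  cycflat S P (dualr r E) E F -> cycflat P S r E (E :\: F).
Proof.
move=> rr [FE fl cy]; have DU x : (E :\: F) :\ x = E :\: (x |: F).
  by rewrite setDDl setUC.
split; first exact: subsetDl.
- move=> x xE; rewrite inE xE andbT negbK => xF xS.
  have := cy x xF xS; have := dualrK rr E F; have := dualrK rr E (F :\ x).
  have -> : E :\: (F :\ x) = x |: (E :\: F).
    by apply/setP=> y; rewrite !inE; case: (y =P x) => [->|] //=; rewrite xE.
  rewrite !(setIidPl _) ?(subset_trans (subsetDl _ _) FE) //.
  by rewrite (cardsD1 x F) xF; lia.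
- move=> x; rewrite inE => /andP[xF xE] xP.
  have := fl x xE xF xP; have := dualrK rr E F; have := dualrK rr E (x |: F).
  have xFE : x |: F \subset E by rewrite subUset sub1set xE.
  rewrite !(setIidPl _) // cardsU1 xF DU.
  by have := rk_mono rr (setDS E (subsetUr [set x] F)); lia.
Qed.

Lemma sorted_proper_dual E (s : seq {set T}) : {in s, forall F, F \subset E} ->
  sorted (fun A B => A \proper B) s ->
  sorted (fun A B => A \proper B) (rev [seq E :\: F | F <- s]).
Proof.
move=> sE ss; rewrite rev_sorted.
apply: (@homo_sorted_in _ _ (mem s)) ss; last exact/allP.
move=> F G Fs Gs /properP[FG [x xG xF]]; apply/properP; split.
  exact: setDS.
exists x; rewrite !inE ?xF ?(subsetP (sE G Gs)) //.
by rewrite xG.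
Qed.

Lemma chain_dual n P S r E : rank_fun r ->
  chain_le n P S r E -> chain_le n S P (dualr r E) E.
Proof.
move=> rr h s ss sc; rewrite -(size_map (fun F => E :\: F)) -size_rev.
apply: h; first by apply: sorted_proper_dual => // F /sc[].
by move=> F; rewrite mem_rev => /mapP[G /sc Gs ->]; apply: cycflat_dual.
Qed.

(** Starting from the flat [F], repeatedly add an element and close up inside [Q]; the rank rises by
    one each time. *)
Lemma flats_chain r Q m F : rank_fun r -> F \subset Q ->
  (forall e, e \in Q -> e \notin F -> (r F < r (e |: F))%N) ->
  (r F + m = r Q)%N ->
  exists s, [/\ path (fun A B => A \proper B) F s, last F s = Q, size s = m
    & forall G, G \in s -> G \subset Q /\
        forall e, e \in Q -> e \notin G -> (r G < r (e |: G))%N].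
Proof.
move=> rr; elim: m => [|m IH] in F *; move=> FQ fl rQ.
  exists [::]; split=> //; apply/eqP; rewrite eqEsubset FQ /=.
  apply/subsetP=> x xQ; apply/negPn/negP=> xF.
  have : x |: F \subset Q by rewrite subUset sub1set xQ.
  by move=> /(rk_mono rr); have := fl x xQ xF; lia.
have [e eQ eF] : exists2 e, e \in Q & e \notin F.
  apply/subsetPn; apply/negP=> /(rk_mono rr); lia.
pose G := [set x in Q | r (x |: (e |: F)) == r (e |: F)].
have cl A : A \subset G -> r (A :|: (e |: F)) = r (e |: F).
  elim/(@set_ind T): A => [|x A xA IHA]; first by rewrite set0U.
  rewrite subUset sub1set => /andP[]; rewrite inE => /andP[_ /eqP hx] /IHA hA.
  by rewrite -setUA -hA; apply: (rk_cl rr (subsetUr _ _) hx).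
have eFG : e |: F \subset G.
  apply/subsetP=> x xeF; rewrite inE (setUidPr _) ?sub1set // eqxx andbT.
  by move: xeF; rewrite !inE => /orP[/eqP->//|]; apply: (subsetP FQ).
have rG : r G = r (e |: F).
  by rewrite -(cl G) // (setUidPl eFG).
have reF : r (e |: F) = (r F).+1.
  by have := fl e eQ eF; have := rk_add1 rr e F; lia.
have GQ : G \subset Q by apply/subsetP=> x; rewrite inE => /andP[].
have flG x : x \in Q -> x \notin G -> (r G < r (x |: G))%N.
  move=> xQ; rewrite inE xQ /= => nx.
  rewrite rG; apply: leq_trans (rk_mono rr (setUS [set x] eFG)).
  by rewrite ltn_neqAle eq_sym nx rk_addge.
have [|s [ps ls ss sf]] := IH G GQ flG; first by rewrite rG reF; lia.
exists (G :: s); split=> //=; last 2 first.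
- by rewrite ss.
- by move=> H; rewrite inE => /orP[/eqP->//|]; apply: sf.
rewrite ps andbT; apply/properP; split.
  exact: subset_trans (subsetUr _ _) eFG.
by exists e => //; apply: (subsetP eFG); rewrite !inE eqxx.
Qed.

(** Any flat of the restriction to [P] qualifies: pairs in [S] need no closure condition and pairs
    in [P] no cyclicity condition. The chain runs from the loops of [P] up to all of [P]. *)
Lemma par_chain P S r E : rank_fun r -> [disjoint P & S] -> E \subset P :|: S ->
  exists F s, [/\ path (fun A B => A \proper B) F s, last F s = E :&: P,
    size s = r (E :&: P) & forall G, G \in F :: s -> cycflat P S r E G].
Proof.
move=> rr PS sub; pose F0 := [set x in E :&: P | r [set x] == 0%N].
have rF0 : r F0 = 0%N.
  by apply: rk_loops => // x; rewrite inE => /andP[_ /eqP].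
have F0Q : F0 \subset E :&: P by apply/subsetP=> x; rewrite inE => /andP[].
have fl x : x \in E :&: P -> x \notin F0 -> (r F0 < r (x |: F0))%N.
  move=> xQ; rewrite inE xQ rF0 /= => x0.
  have := rk_mono rr (subsetUl [set x] F0); lia.
have rQ : (r F0 + r (E :&: P) = r (E :&: P))%N by rewrite rF0.
have [s [ps ls ss sf]] := flats_chain rr F0Q fl rQ.
exists F0, s; split=> //.
move=> G Gs; have [GQ flG] : G \subset E :&: P /\
    forall e, e \in E :&: P -> e \notin G -> (r G < r (e |: G))%N.
  by move: Gs; rewrite inE => /orP[/eqP->//|]; apply: sf.
split.
- exact: subset_trans GQ (subsetIl _ _).
- move=> e eE eG eS; apply: flG => //; rewrite inE eE.
  by have := subsetP sub e eE; rewrite inE (negPf eS) orbF.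
by move=> e /(subsetP GQ); rewrite inE => /andP[_ ->].
Qed.

(** The chain below [P] is continued by the complements of the dual chain below [S]. The two meet in
    E - S = P, giving r(P) + r*(S) + 1 members. *)
Lemma chain_pair_rank n P S r E : rank_fun r -> [disjoint P & S] ->
  E \subset P :|: S -> chain_le n.+1 P S r E -> (pair_rank P S r E <= n)%N.
Proof.
move=> rr PS sub h.
have [F [s [ps ls ss sf]]] := par_chain rr PS sub.
have SP : [disjoint S & P] by rewrite disjoint_sym.
have sub' : E \subset S :|: P by rewrite setUC.
have [G [t [pt lt st tf]]] := par_chain (dualr_rank rr E) SP sub'.
have ES : E :\: (E :&: S) = E :&: P.
  apply/setP=> x; have := subsetP sub x; rewrite !inE.
  case: (boolP (x \in E)) => //= _.
  move=> /(_ isT); case: (boolP (x \in P)) => [xP|_ /= ->] //.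
  by rewrite (notS PS xP).
have so : sorted (fun A B => A \proper B) (rev [seq E :\: A | A <- G :: t]).
  by apply: sorted_proper_dual => // A /tf[].
have fo A : A \in rev [seq E :\: A | A <- G :: t] -> cycflat P S r E A.
  by rewrite mem_rev => /mapP[B /tf Bs ->]; apply: cycflat_dual.
(* After reversal the last dual flat comes first; its complement is the common member [E :&: P],
   split off so that it is counted once. *)
move: so fo; rewrite lastI map_rcons rev_rcons lt ES.
set u := rev _ => /= pu fu.
have su : size u = dualr r E (E :&: S).
  by rewrite size_rev size_map size_belast.
have := h (F :: (s ++ u)); rewrite /= cat_path ps ls pu => /(_ isT).
rewrite size_cat ss su /pair_rank dualr_sub ?subsetIl // setDIr setDv set0U ltnS.
apply=> A; rewrite -cat_cons mem_cat => /orP[|Au]; first exact: sf.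
by apply: fu; rewrite inE Au orbT.
Qed.

End Chains.

(** * Removing the elements that are not doubled *)

Section Reduction.

Variable T : finType.
Implicit Types (A B E F P S : {set T}) (e f : T) (r : {set T} -> nat).

Definition ratio_ge_ih E : Prop := forall P S r F, rank_fun r ->
  [disjoint P & S] -> valid P S r F -> chain_le 6 P S r F ->
  (#|F| < #|E|)%N -> ratio_ge 1 P S r F.

Lemma ratio_ge1_par_par P S r E e f : rank_fun r -> [disjoint P & S] ->
  valid P S r E -> chain_le 6 P S r E -> ratio_ge_ih E -> e \in E -> f \in E ->
  e != f -> e \in P -> f \in P -> r [set e; f] = 1%N -> ratio_ge 1 P S r E.
Proof.
move=> rr PS v ch ih eE fE ef eP fP ef1.
have nl x : x \in E -> x \in P -> r [set x] = 1%N.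
  move=> xE xP; have := rk1 rr x; case h : (r [set x]) => [|[]] // _.
  by have := (v x xE).1 h; rewrite (notS PS).
apply: (ratio_ge_par_par PS rr ef eE fE eP fP (nl e eE eP) (nl f fE fP) ef1) => //.
apply: ih => //; last by rewrite (cardsD1 f E) fE.
  exact: valid_par rr eE fE ef eP (nl e eE eP) ef1 v.
exact: chain_del.
Qed.

Lemma ratio_ge1_single_par P S r E e f : rank_fun r -> [disjoint P & S] ->
  valid P S r E -> chain_le 6 P S r E -> ratio_ge_ih E -> e \in E -> f \in E ->
  e != f -> e \notin P -> e \notin S -> f \notin P -> f \notin S ->
  r [set e; f] = 1%N -> ratio_ge 1 P S r E.
Proof.
move=> rr PS v ch ih eE fE ef eP eS fP fS ef1.
have nl x : x \in E -> x \notin S -> r [set x] = 1%N.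
  move=> xE xS; have := rk1 rr x; case h : (r [set x]) => [|[]] // _.
  by have := (v x xE).1 h; rewrite (negPf xS).
have e1 := nl e eE eS; have f1 := nl f fE fS.
suff : ratio_ge 1 (e |: P) S r (E :\ f).
  by rewrite /ratio_ge !(tw_merge _ _ rr ef eE fE eP eS fP fS e1 f1 ef1).
have PS' : [disjoint e |: P & S].
  by rewrite disjoints_subset subUset sub1set inE eS -disjoints_subset.
apply: ih => //; last by rewrite (cardsD1 f E) fE.
  apply: valid_par rr eE fE ef _ e1 ef1 _; first by rewrite !inE eqxx.
  by move=> x xE; have [v1 v2] := v x xE; split=> // /v2 xP; rewrite !inE xP orbT.
exact: chain_merge.
Qed.

Lemma ratio_ge1_triple P S r E e f : rank_fun r -> [disjoint P & S] ->
  valid P S r E -> chain_le 6 P S r E -> ratio_ge_ih E -> e \in E -> f \in E ->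
  e \notin P -> e \notin S -> f \in P -> r [set e; f] = 1%N ->
  (forall g, g \in E -> g != e -> g != f -> r [set e; g] = 1%N -> g \in S) ->
  ratio_ge 1 P S r E.
Proof.
move=> rr PS v ch ih eE fE eP eS fP ef1 par.
have nl x : x \in E -> x \notin S -> r [set x] = 1%N.
  move=> xE xS; have := rk1 rr x; case h : (r [set x]) => [|[]] // _.
  by have := (v x xE).1 h; rewrite (negPf xS).
have e1 := nl e eE eS; have f1 := nl f fE (negbT (notS PS fP)).
have fe : f != e by apply: contraNneq eP => <-.
have fe1 : r [set f; e] = 1%N by rewrite setUC.
have cE : #|E| = #|E :\ e|.+1 := card_del eE.
have fEe : f \in E :\ e by rewrite !inE fe.
have rre := ctr_rank rr e.
apply: (ratio_ge_triple_step PS rr eE fE eP eS fP e1 f1 ef1); apply: ih => //.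
- exact: valid_par rr fE eE fe fP f1 fe1 v.
- exact: chain_del.
- by rewrite cE.
- move=> x; rewrite !inE => /and3P[xf xe xE]; split=> h.
    by apply: par => //; have := ctrK rr e [set x]; rewrite h e1.
  apply: (v x xE).2; have nf : e |: (E :\ e :\ f) = E :\ f.
    by rewrite setD1_swap // eq_sym.
  have nx : e |: (E :\ e :\ f :\ x) = E :\ f :\ x.
    rewrite -(setD1_swap (_ : e \in E :\ f) (_ : e != x)) ?inE 1?eq_sym ?xe //.
      by rewrite (setD1C E f e).
    by rewrite fe.
  have := ctrK rr e (E :\ e :\ f :\ x); have := ctrK rr e (E :\ e :\ f).
  rewrite nf nx (par_setD1 rr eE fE _ _ _ e1 ef1) 1?eq_sym //.
  rewrite e1; have := h; have := rk_setD1_le rr f E; clear; lia.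
- apply: chain_del => //; exact: chain_ctr.
by rewrite cE (card_del fEe) ltnS leqnSn.
Qed.

Theorem ratio_ge1 P S r E : rank_fun r -> [disjoint P & S] -> valid P S r E ->
  chain_le 6 P S r E -> ratio_ge 1 P S r E.
Proof.
have [n] := ubnP #|E|; elim: n => // n IH in P S r E *; move=> ltn rr PS v ch.
have ih : ratio_ge_ih E.
  move=> P' S' r' F rr' PS' v' ch' ltF; apply: IH => //.
  by apply: leq_trans ltF _.
have rrd := dualr_rank rr E; have vd := valid_dual rr v.
have chd := chain_dual rr ch.
have SP : [disjoint S & P] by rewrite disjoint_sym.
have [sub|/subsetPn[e eE]] := boolP (E \subset P :|: S).
  have k5 := chain_pair_rank rr PS sub ch.
  exact: ratio_ge_le (ratio_lb_ge1 _ _ _) (thick_ratio (Thick rr PS v sub) k5).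
rewrite inE negb_or => /andP[eP eS].
have e1 : r [set e] = 1%N.
  have := rk1 rr e; case h : (r [set e]) => [|[]] // _.
  by have := (v e eE).1 h; rewrite (negPf eS).
have nce : r (E :\ e) = r E.
  apply/eqP; rewrite eqn_leq rk_setD1_le // leqNgt.
  by apply: contra eP => /((v e eE).2).
(* These are the partners that block the deletion-contraction step: contracting [e] makes [f] a loop
   outside [S], or deleting [e] makes [f] a coloop outside [P]. *)
pose pp f := [&& f != e, f \notin S & r [set e; f] == 1%N].
pose ss f := [&& f != e, f \notin P & dualr r E [set e; f] == 1%N].
have step P' S' r' : rank_fun r' -> [disjoint P' & S'] -> valid P' S' r' E ->
    chain_le 6 P' S' r' E -> e \notin P' -> e \notin S' -> r' [set e] = 1%N ->
    (exists f, [/\ f \in E, f != e, f \notin S' & r' [set e; f] = 1%N]) ->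
    ratio_ge 1 P' S' r' E.
  move=> {rr PS v ch rrd vd chd SP e1 nce pp ss eP eS} rr PS v ch eP eS e1.
  case=> f [fE fe fS ef1]; have ef : e != f by rewrite eq_sym.
  have [fP|fP] := boolP (f \in P'); last exact: ratio_ge1_single_par ef1.
  (* A second partner [g] leaves two undoubled parallel elements to merge or two parallel pairs to
     shorten. Without it, contracting [e] and removing the pair [f] yields a valid matroid. *)
  have [/exists_inP[g gE /and3P[ge gf /andP[gS /eqP eg1]]]|npar] :=
    boolP [exists g in E, [&& g != e, g != f & (g \notin S') && (r' [set e; g] == 1%N)]].
    have eg : e != g by rewrite eq_sym.
    have [gP|gP] := boolP (g \in P'); last exact: ratio_ge1_single_par eg1.
    have fg : f != g by rewrite eq_sym.
    apply: (ratio_ge1_par_par rr PS v ch ih fE gE fg fP gP).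
    have f1 : r' [set f] = 1%N.
      have := rk1 rr f; case h : (r' [set f]) => [|[]] // _.
      by have := (v f fE).1 h; rewrite (negPf fS).
    have := par_ctr [set g] rr e1 f1 ef1.
    have := ctrK rr e [set g]; have := ctrK rr f [set g]; rewrite e1 f1 eg1.
    by clear; lia.
  apply: (ratio_ge1_triple rr PS v ch ih eE fE eP eS fP ef1) => g gE ge gf eg1.
  apply/negPn/negP=> gS; case/negP: npar; apply/exists_inP; exists g => //.
  by rewrite ge gf gS eg1.
have [/exists_inP[f fE /and3P[fe fS /eqP ef1]]|npar] := boolP [exists f in E, pp f].
  by apply: step => //; exists f.
have [/exists_inP[f fE /and3P[fe fP /eqP ef1]]|nser] := boolP [exists f in E, ss f].
  apply: ratio_ge_dual => //; apply: step => //; last by exists f.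
  by have := dualr1 rr eE; rewrite nce; clear; lia.
(* No partner blocks either minor, so both are valid. *)
apply: (ratio_ge_single_step rr eE eP eS e1 nce); apply: ih => //.
- move=> x; rewrite !inE => /andP[xe xE]; split; first exact: (v x xE).1.
  move=> cl; apply/negPn/negP=> xP; case/negP: nser; apply/exists_inP; exists x => //.
  rewrite /ss xe xP /=; have ex : e != x by rewrite eq_sym.
  have := dualr2 rr ex eE xE; have := rk_setD1 rr x (E :\ e).
  by move: cl; rewrite nce; clear; lia.
- exact: chain_del.
- by rewrite (card_del eE).
- exact: ctr_rank.
- apply: (valid_ctr rr eE e1 _ v) => f fE fe ef1.
  apply/negPn/negP=> fS; case/negP: npar; apply/exists_inP; exists f => //.
  by rewrite /pp fe fS ef1.
- exact: chain_ctr.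
by rewrite (card_del eE).
Qed.

End Reduction.

(** * From matroids to rank functions *)

Section MatroidRank.

Variables (T : finType) (M : matroid T).
Implicit Types (A B F I J : {set T}) (e : T).

Lemma rank_ge I A : indep M I -> I \subset A -> (#|I| <= rank M A)%N.
Proof.
by move=> iI IA; apply: (leq_bigmax_cond (P := fun I => indep M I && (I \subset A)));
   rewrite iI.
Qed.

Lemma rank_basis A : exists I, [/\ indep M I, I \subset A & #|I| = rank M A].
Proof.
have P0 : indep M set0 && (set0 \subset A) by rewrite indep0 sub0set.
rewrite /rank (bigop.bigmax_eq_arg set0) //.
by case: arg_maxnP => // I /andP[iI IA] _; exists I.
Qed.

Lemma indep_extend I A : indep M I -> I \subset A ->
  exists J, [/\ indep M J, I \subset J, J \subset A & #|J| = rank M A].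
Proof.
have [n] := ubnP (rank M A - #|I|)%N; elim: n => // n IH in I *.
move=> lt_n iI IA; have := rank_ge iI IA; rewrite leq_eqVlt => /predU1P[eqI|ltI].
  by exists I.
have [K [iK KA cK]] := rank_basis A; rewrite -cK in ltI.
have [e] := indep_aug iI iK ltI; rewrite inE => /andP[eI eK] ieI.
have eA : e |: I \subset A by rewrite subUset sub1set (subsetP KA).
have [|J [iJ IJ JA cJ]] := IH (e |: I) _ ieI eA.
  by move: lt_n ltI; rewrite cardsU1 eI cK; clear; lia.
by exists J; split=> //; apply: subset_trans IJ; apply: subsetUr.
Qed.

Lemma rank_rank_fun : rank_fun (rank M).
Proof.
split=> [|A B AB|e A|e A B AB rA].
- have [I [_ + <-]] := rank_basis set0.
  by rewrite subset0 => /eqP ->; rewrite cards0.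
- have [I [iI IA <-]] := rank_basis A.
  by apply: rank_ge => //; apply: subset_trans AB.
- have [I [iI IA <-]] := rank_basis (e |: A).
  have : (#|I :\ e| <= rank M A)%N.
    apply: rank_ge; first by apply: indepS iI; apply: subsetDl.
    by rewrite subDset.
  by rewrite (cardsD1 e I); case: (e \in I) => /=; lia.
have [I [iI IA cI]] := rank_basis A.
have [J [iJ IJ JB cJ]] := indep_extend iI (subset_trans IA AB).
apply/eqP; rewrite eqn_leq; apply/andP; split; last first.
  by rewrite -cJ; apply: rank_ge => //; apply: subset_trans JB (subsetUr _ _).
rewrite leqNgt; apply/negP=> lt; have [K [iK KB cK]] := rank_basis (e |: B).
rewrite -cK -cJ in lt; have [x] := indep_aug iJ iK lt.
rewrite inE => /andP[xJ xK] ixJ.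
(* [J] is maximal in [B], so only [e] can augment it; then [e |: I] is an independent subset of
   [e |: A] larger than the rank of [A]. *)
have xe : x = e.
  have := subsetP KB x xK; rewrite !inE => /orP[/eqP//|xB].
  have : x |: J \subset B by rewrite subUset sub1set xB.
  by move=> /(rank_ge ixJ); rewrite cardsU1 xJ cJ add1n ltnn.
have eI : e \notin I by rewrite -xe; apply: contra xJ; apply: subsetP.
have ieI : indep M (e |: I) by apply: indepS ixJ; rewrite xe setUS.
by have := rank_ge ieI (setUS [set e] IA); rewrite rA cardsU1 eI cI add1n ltnn.
Qed.

Lemma rank_circuit F e : e \in F -> rank M (F :\ e) = rank M F ->
  exists C, [/\ is_circuit M C, C \subset F & e \in C].
Proof.
move=> eF rF; have [I [iI IF cI]] := rank_basis (F :\ e).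
have eI : e \notin I by move: IF; rewrite subsetD1 => /andP[].
have IF' : I \subset F := subset_trans IF (subsetDl _ _).
have eIF : e |: I \subset F by rewrite subUset sub1set eF.
have nI : predC (indep M) (e |: I).
  by apply/negP=> /rank_ge/(_ eIF); rewrite cardsU1 eI cI rF; lia.
have [C cC CI] := minset_exists nI.
exists C; split=> //; first exact: subset_trans CI eIF.
have /minsetP[/negP nC _] := cC.
apply/negPn/negP=> eC; apply: nC; apply: indepS iI.
apply/subsetP=> x xC; have := subsetP CI x xC; rewrite !inE => /orP[/eqP xe|//].
by rewrite -xe xC in eC.
Qed.

(** With [P] and [S] empty, the last condition of [cycflat] says that the restriction to [F] has no
    coloop, so each element of [F] lies on a circuit inside [F]. *)
Lemma cycflat_cyclic_flat F : cycflat set0 set0 (rank M) setT F ->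
  F \in cyclic_flats M.
Proof.
case=> _ fl cy; rewrite inE; apply/andP; split.
  by apply/forall_inP=> e; rewrite inE => eF; apply: fl; rewrite ?inE.
apply/existsP; exists [set C : {set T} | is_circuit M C && (C \subset F)].
apply/andP; split; first by apply/forall_inP=> C; rewrite inE => /andP[].
rewrite eqEsubset; apply/andP; split.
  by apply/bigcupsP=> C; rewrite inE => /andP[].
apply/subsetP=> e eF; have [|C [cC CF eC]] := rank_circuit eF.
  by apply: cy; rewrite ?inE.
by apply/bigcupP; exists C => //; rewrite inE cC.
Qed.

Lemma CH_chain_le k : CH k M -> chain_le k set0 set0 (rank M) setT.
Proof.
move=> ch s ss sc; apply: leq_trans ch; rewrite /height.
have tr : transitive (fun A B : {set T} => A \proper B).
  by move=> B A C; apply: proper_trans.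
have us : uniq s by apply: sorted_uniq ss => // A; apply: properxx.
have <- : #|[set A in s]| = size s by rewrite cardsE; apply/card_uniqP.
apply: (leq_bigmax_cond (P := fun C => is_chain C && (C \subset cyclic_flats M))).
apply/andP; split; last first.
  by apply/subsetP=> A; rewrite inE => /sc/cycflat_cyclic_flat.
suff h A B : A \in s -> B \in s -> (A \subset B) || (B \subset A).
  by apply/forall_inP=> A; rewrite inE => As; apply/forall_inP=> B;
     rewrite inE; apply: h.
move: ss; rewrite sorted_pairwise //.
elim: s {sc us} => //= C s IH /andP[/allP hC /IH{}IH].
rewrite !inE => /predU1P[->|As] /predU1P[->|Bs].
- by rewrite subxx.
- by rewrite (proper_sub (hC B Bs)).
- by rewrite (proper_sub (hC A As)) orbT.
exact: IH.
Qed.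

Lemma loopless_valid : (forall e, ~~ is_loop M e) ->
  (forall e, ~~ is_coloop M e) -> valid set0 set0 (rank M) setT.
Proof.
move=> nl ncl e _; split=> h.
  case/negP: (nl e); apply/minsetP; split.
    by apply/negP=> /rank_ge/(_ (subxx _)); rewrite h cards1.
  move=> B nB; rewrite subset1 => /predU1P[//|/eqP B0].
  by case/negP: nB; rewrite B0 indep0.
case/negP: (ncl e); apply/forall_inP=> B /maxsetP[iB mB].
apply/negPn/negP=> eB; have [J [iJ BJ _ cJ]] := indep_extend iB (subsetT B).
rewrite (mB J iJ BJ) in cJ.
have : B \subset setT :\ e by rewrite subsetD1 subsetT.
by move=> /(rank_ge iB); rewrite cJ leqNgt h.
Qed.

Lemma tutte_tw (X Y : int) :
  ((tutte M).[X, Y])%:~R = tw X%:~R Y%:~R set0 set0 (rank M) setT.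
Proof.
rewrite /tutte /tw !horner_sum rmorph_sum /=.
rewrite [RHS](eq_bigl predT) => [|A]; last by rewrite subsetT.
apply: eq_bigr => A _.
rewrite !setI0 !cards0 !expr0 !mulr1 !hornerE /=.
by rewrite !(rmorphM, rmorphXn, rmorphB) /= rmorph1.
Qed.

End MatroidRank.

Theorem theorem3 (T : finType) (M : matroid T)
    (loopless : forall e : T, ~~ is_loop M e)
    (coloopless : forall e : T, ~~ is_coloop M e)
    (chM : CH 6 M) :
  (tutte M).[2, 0] * (tutte M).[0, 2] >= (tutte M).[1, 1] ^+ 2.
Proof.
have disj : [disjoint (set0 : {set T}) & (set0 : {set T})].
  by rewrite -setI_eq0 setI0.
have := ratio_ge1 (rank_rank_fun M) disj (loopless_valid loopless coloopless)
  (CH_chain_le chM).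
rewrite /ratio_ge mul1r -(ler_int rat) rmorphXn rmorphM /=.
by rewrite !tutte_tw.
Qed.
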